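(* Let $d\in\mathbb{N}=\{0,1,2,\ldots\}$, $n\in\{1,2,\ldots\}$, $\boldsymbol{\alpha}=(\alpha_1,\ldots,\alpha_n)$ with $0<\alpha_1\le\cdots\le\alpha_n<+\infty$, and let $\mathbb{H}(d,\boldsymbol{\alpha})$ be the corank $1$ Carnot group with projections $\pi_1,\ldots,\pi_{d+2n}:\mathbb{H}(d,\boldsymbol{\alpha})\to\mathbb{R}^{d+2n}$. Then $$\int_{\mathbb{H}(d,\boldsymbol{\alpha})}\prod_{j=1}^{d+2n} f_j(\pi_j(x,t))\,dx\,dt\le \mathbf{C}(d,\boldsymbol{\alpha})\prod_{j=1}^{d}\|f_j\|_{d+2n+1}\prod_{j=d+1}^{d+2n}\|f_j\|_{\frac{n(d+2n+1)}{n+1}}$$ for all non-negative measurable functions $f_1,\ldots,f_{d+2n}$ on $\mathbb{R}^{d+2n}$, where $$\mathbf{C}(d,\boldsymbol{\alpha}):=\frac{\|\mathbf{R}\|_{\frac32\to3}^{\frac{3}{d+2n+1}}}{\left(\prod_{j=1}^n\alpha_j\right)^{\frac{1}{n(d+2n+1)}}},$$ and $\|\mathbf{R}\|_{\frac32\to3}<+\infty$ denotes the operator norm of the Radon transform $\mathbf{R}$ from $L^{3/2}(\mathbb{R}^2)$ to $L^3(\mathbb{S}^1\times\mathbb{R})$.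
   Context: The group $\mathbb{H}(d,\boldsymbol{\alpha})$ is $\mathbb{R}^{d+2n}\times\mathbb{R}\cong\mathbb{R}^{d+2n+1}$ (points $(x,t)$, $x\in\mathbb{R}^{d+2n}$, $t\in\mathbb{R}$) with group law $$(x,t)\cdot(x',t')=\Big(x+x',\,t+t'+\tfrac12\sum_{j=1}^n\alpha_j(x_{d+2j-1}x'_{d+2j}-x_{d+2j}x'_{d+2j-1})\Big),$$ and $dx\,dt$ is Lebesgue measure. For $x\in\mathbb{R}^{d+2n}$, $\hat x_j\in\mathbb{R}^{d+2n-1}$ is obtained from $x$ by deleting the $j$-th coordinate. The projections $\pi_j:\mathbb{R}^{d+2n+1}\to\mathbb{R}^{d+2n}$ are - $\pi_j(x,t)=(\hat x_j,t)$ for $1\le j\le d$; - $\pi_{d+2j-1}(x,t)=\big(\hat x_{d+2j-1},\,t+\tfrac{\alpha_j}{2}x_{d+2j-1}x_{d+2j}\big)$ for $1\le j\le n$; - $\pi_{d+2j}(x,t)=\big(\hat x_{d+2j},\,t-\tfrac{\alpha_j}{2}x_{d+2j-1}x_{d+2j}\big)$ for $1\le j\le n$. $\|f\|_p$ is the $L^p$ norm (with respect to Lebesgue measure, possibly $+\infty$); $0\cdot\infty=0$. The Radon transform is $\mathbf{R}f(\sigma,s):=\int_{\{x\in\mathbb{R}^2:\langle x,\sigma\rangle=s\}}f(x)\,dx$ for $\sigma\in\mathbb{S}^1=\{x\in\mathbb{R}^2:|x|=1\}$, $s\in\mathbb{R}$, where $dx$ is $1$-dimensional Lebesgue measure on the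 line. $\mathbb{S}^1\times\mathbb{R}$ carries the product of arc-length measure (total mass $2\pi$) and Lebesgue measure. It is a known fact that $\mathbf{R}$ is bounded from $L^{3/2}(\mathbb{R}^2)$ to $L^3(\mathbb{S}^1\times\mathbb{R})$. *)

(* Defs.v *)
From HB Require Import structures.
From mathcomp Require Import all_boot all_order all_algebra.
From mathcomp Require Import all_classical all_reals all_analysis measurable_realfun.
Import Order.TTheory GRing.Theory Num.Theory.
Import numFieldNormedType.Exports.

Set Implicit Arguments.
Unset Strict Implicit.
Unset Printing Implicit Defensive.

Local Open Scope classical_set_scope.
Local Open Scope ring_scope.

(* $\mathbb{R}^n$ is [n.-tuple (measurableTypeR R)] with its product
   sigma-algebra; [measurableTypeR R] is [R] with the Borel structure on which
   [lebesgue_measure] is defined. *)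
Section lebesgue_Rn.
Variable R : realType.
Local Notation mR := (measurableTypeR R).

Definition cons_Rn (n : nat) (p : mR * n.-tuple mR) : n.+1.-tuple mR :=
  [tuple of p.1 :: p.2].

Lemma measurable_cons_Rn n : measurable_fun [set: mR * n.-tuple mR] (@cons_Rn n).
Proof. exact: measurable_cons. Qed.

Section step.
Local Open Scope ereal_scope.
Context (n : nat) (mu : {sigma_finite_measure set (n.-tuple mR) -> \bar R}).

Definition lebesgue_step : set (n.+1.-tuple mR) -> \bar R :=
  pushforward (@lebesgue_measure R \x mu) (@cons_Rn n).

Let step0 : lebesgue_step set0 = 0.
Proof. by rewrite /lebesgue_step /pushforward preimage_set0 measure0. Qed.

Let step_ge0 A : 0 <= lebesgue_step A.
Proof. exact: (measure_ge0 (lebesgue_measure \x mu)). Qed.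

Let step_sigma_additive : semi_sigma_additive lebesgue_step.
Proof.
exact: (@measure_semi_sigma_additive _ _ _
  (measure_function_pushforward__canonical__measure_function_Measure
     (lebesgue_measure \x mu) (@measurable_cons_Rn n))).
Qed.

HB.instance Definition _ := isMeasure.Build _ _ _ lebesgue_step
  step0 step_ge0 step_sigma_additive.

Let step_sigma_finite : sigma_finite setT lebesgue_step.
Proof.
have /sigma_finiteP[F [TF ndF Foo]] := sigma_finiteT (@lebesgue_measure R).
have /sigma_finiteP[G [TG ndG Goo]] := sigma_finiteT mu.
pose u (t : n.+1.-tuple mR) : mR * n.-tuple mR := (thead t, [tuple of behead t]).
have uK p : u (cons_Rn p) = p.
  by case: p => x t; rewrite /u /cons_Rn theadE; congr pair; exact: val_inj.
have mu_ : measurable_fun setT u.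
  by apply: measurable_fun_pair;
    [exact: measurable_tnth|exact: measurable_behead].
exists (fun k => u @^-1` (F k `*` G k)).
  rewrite -preimage_bigcup; apply/esym; rewrite -subTset => t _ /=.
  have [i _ Fi] : (\bigcup_i F i) (thead t) by rewrite -TF.
  have [j _ Gj] : (\bigcup_i G i) [tuple of behead t] by rewrite -TG.
  exists (maxn i j) => //; split=> /=.
    by move: Fi; exact/subsetPset/ndF/leq_maxl.
  by move: Gj; exact/subsetPset/ndG/leq_maxr.
move=> k; have [mF Fk] := Foo k; have [mG Gk] := Goo k; split.
  by rewrite -[X in measurable X]setTI; apply: mu_ => //; exact: measurableX.
rewrite /lebesgue_step /pushforward (_ : _ @^-1` _ = F k `*` G k).
  by rewrite product_measure1E// lte_mul_pinfty// ge0_fin_numE.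
by rewrite -comp_preimage (_ : u \o _ = id) ?preimage_id//; apply/funext.
Qed.

HB.instance Definition _ := Measure_isSigmaFinite.Build _ _ _ lebesgue_step
  step_sigma_finite.

End step.

(* n-dimensional Lebesgue measure, as the n-fold product of the Lebesgue
   measure of the real line. *)
Fixpoint lebesgue_Rn n : {sigma_finite_measure set (n.-tuple mR) -> \bar R} :=
  match n with
  | 0 => dirac [tuple]
  | m.+1 => lebesgue_step (lebesgue_Rn m)
  end.

Lemma lebesgue_RnE n (A : 'I_n -> set mR) : (forall i, measurable (A i)) ->
  lebesgue_Rn n [set x | forall i, A i (tnth x i)] =
  (\prod_(i < n) lebesgue_measure (A i))%E.
Proof.
elim: n A => [|n IHn] A mA /=.
  rewrite big_ord0 diracE; rewrite (_ : _ \in _ = true)//.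
  by apply/mem_set => -[].
rewrite big_ord_recl -IHn; last by move=> i; exact: mA.
rewrite -product_measure1E//; last first.
  rewrite (_ : mkset _ = \bigcap_(i in [set: 'I_n])
      ((fun x : n.-tuple mR => tnth x i) @^-1` A (lift ord0 i))); last first.
    by apply/seteqP; split=> x /= Ax i; [move=> _; exact: Ax|exact: Ax].
  apply: fin_bigcap_measurable => // i _.
  by rewrite -[X in measurable X]setTI; apply: measurable_tnth => //; exact: mA.
rewrite /lebesgue_step /pushforward; congr (product_measure1 _ _ _).
apply/seteqP; split=> -[a x] /=.
  by move=> Ax; split=> [|i]; [exact: (Ax ord0)|have := Ax (lift ord0 i); rewrite tnthS].
move=> [Aa Ax] i; case: (unliftP ord0 i) => [j|] ->//.
by rewrite tnthS; exact: Ax.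
Qed.

End lebesgue_Rn.

(* Lebesgue measurability, i.e. with respect to the completion of the Borel
   sigma-algebra. For a nonnegative function the library's integral is a
   supremum over the Borel simple functions below it, so on
   [mu_measurable mu] functions it is the integral against the completion. *)
Definition mu_measurable d (T : measurableType d) (R : realType)
    (mu : set T -> \bar R) (f : T -> \bar R) : Prop :=
  forall Y : set (\bar R), measurable Y -> completed_algebra_gen mu (f @^-1` Y).

Section arc_length.
Variable R : realType.
Local Notation mR := (measurableTypeR R).

Definition circle_param (theta : mR) : mR * mR := (cos theta, sin theta).

Lemma measurable_circle_param : measurable_fun [set: mR] circle_param.
Proof.
apply: measurable_fun_pair; apply: continuous_measurable_fun.
  exact: continuous_cos.
exact: continuous_sin.
Qed.

#[local] Hint Resolve measurable_circle_param : core.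

Lemma measurable_turn : measurable (`[0, 2 * pi[ : set mR).
Proof. exact: measurable_itv. Qed.

(* Arc-length measure of the unit circle, as a measure on the plane
   concentrated on the circle. *)
Definition arc_length : set (mR * mR)%type -> \bar R :=
  pushforward (mrestr (@lebesgue_measure R) measurable_turn) circle_param.

Let arc_length0 : arc_length set0 = 0%E. Proof. exact: measure0. Qed.

Let arc_length_ge0 A : (0 <= arc_length A)%E. Proof. exact: measure_ge0. Qed.

Let arc_length_sigma_additive : semi_sigma_additive arc_length.
Proof. exact: measure_semi_sigma_additive. Qed.

HB.instance Definition _ := isMeasure.Build _ _ _ arc_length
  arc_length0 arc_length_ge0 arc_length_sigma_additive.

End arc_length.
Arguments arc_length R : clear implicits.

Section radon.
Variable R : realType.
Local Notation mR := (measurableTypeR R).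

Definition lebesgue_plane : {measure set (mR * mR)%type -> \bar R} :=
  (@lebesgue_measure R \x @lebesgue_measure R)%E.

Definition arc_lebesgue : {measure set (mR * mR * mR)%type -> \bar R} :=
  (arc_length R \x @lebesgue_measure R)%E.

(* For [sigma] on the unit circle, [u |-> s * sigma + u * (- sigma.2, sigma.1)]
   is a unit-speed parametrization of the line [<x, sigma> = s]. The values at
   other [sigma] are irrelevant, since [arc_lebesgue] does not charge them. *)
Definition radon (f : mR * mR -> R) (p : mR * mR * mR) : \bar R :=
  let: (sigma, s) := p in
  (\int[@lebesgue_measure R]_u
     (f (s * sigma.1 - u * sigma.2, s * sigma.2 + u * sigma.1))%:E)%E.

(* Operator norm from $L^{3/2}(\mathbb{R}^2)$ to $L^3(S^1 \times \mathbb{R})$: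
   every class in $L^{3/2}$ has a Borel representative, and changing it on a
   null set changes its transform on a null set only. *)
Definition radon_norm : \bar R :=
  ereal_sup [set 'N[arc_lebesgue]_(3%:E)[radon f] | f in
    [set f : mR * mR -> R | f \in Lfun lebesgue_plane (3 / 2)%:E /\
      'N[lebesgue_plane]_((3 / 2)%:E)[EFin \o f] <= 1]]%E.

End radon.

Section corank1.
Variables (R : realType) (d n : nat).
Local Notation mR := (measurableTypeR R).

(* Points [(x, t)] of $\mathbb{H}(d, \alpha)$. Coordinates are numbered from 0:
   $x_{d+2j-1}$ and $x_{d+2j}$, for $1 \le j \le n$, are [x`_(d + 2 * k)] and
   [x`_(d + 2 * k).+1] with [k = j - 1], and $\alpha_j$ is [alpha`_k]. *)
Definition heis : Type := ((d + 2 * n).-tuple mR * mR)%type.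

Definition heis_mul (alpha : n.-tuple R) (p q : heis) : heis :=
  ([tuple tnth p.1 i + tnth q.1 i | i < d + 2 * n],
   p.2 + q.2 + 2^-1 * \sum_(k < n) alpha`_k *
     (p.1`_(d + 2 * k) * q.1`_(d + 2 * k).+1 -
      p.1`_(d + 2 * k).+1 * q.1`_(d + 2 * k))).

(* The target $\mathbb{R}^{d+2n}$ of the projections, whose points are written
   $(\hat x_j, t)$. *)
Definition heis_base : Type := ((d + 2 * n).-1.-tuple mR * mR)%type.

Definition lebesgue_heis :
    {measure set ((d + 2 * n).-tuple mR * mR)%type -> \bar R} :=
  (lebesgue_Rn R (d + 2 * n) \x @lebesgue_measure R)%E.

Definition lebesgue_base :
    {measure set ((d + 2 * n).-1.-tuple mR * mR)%type -> \bar R} :=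
  (lebesgue_Rn R (d + 2 * n).-1 \x @lebesgue_measure R)%E.

Definition del_coord m (j : 'I_m) (x : m.-tuple mR) : m.-1.-tuple mR :=
  [tuple tnth x (lift j i) | i < m.-1].

Definition heis_proj (alpha : n.-tuple R) (j : 'I_(d + 2 * n)) (p : heis) :
    heis_base :=
  let: (x, t) := p in
  let k := (j - d)./2 in
  let a := alpha`_k / 2 * (x`_(d + 2 * k) * x`_(d + 2 * k).+1) in
  (del_coord j x,
   if (j < d)%N then t else if odd (j - d) then t - a else t + a).

(* [heis_proj alpha j] cancels the j-th coordinate by a right translation. *)
Lemma heis_projE (alpha : n.-tuple R) (j : 'I_(d + 2 * n)) (p : heis) :
  heis_proj alpha j p =
  let q := heis_mul alpha p
    ([tuple if i == j then - tnth p.1 i : R else 0 | i < d + 2 * n], 0) in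
  (del_coord j q.1, q.2).
Proof.
case: p => x t /=; congr pair.
  apply/eq_from_tnth => i; rewrite !tnth_mktuple.
  by rewrite eq_sym (negbTE (neq_lift _ _)) addr0.
pose y : (d + 2 * n).-tuple mR :=
  [tuple if i == j then - tnth x i : R else 0 | i < d + 2 * n].
rewrite -/y.
have yE m : (m < d + 2 * n)%N ->
    y`_m = if m == j :> nat then - (x`_m : R) else 0.
  by move=> mn; rewrite -(tnth_nth _ y (Ordinal mn)) tnth_mktuple (tnth_nth 0).
have kltn (k : 'I_n) : ((d + 2 * k).+1 < d + 2 * n)%N.
  by rewrite -addnS ltn_add2l !mul2n ltn_Sdouble.
rewrite addr0; have [jd|dj] := ltnP j d.
  rewrite big1 ?mulr0 ?addr0// => k _.
  rewrite !yE ?(ltnW (kltn k))// !gtn_eqF ?mulr0 ?subr0 ?mulr0//.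
    by rewrite (leq_trans jd)// leq_addr.
  by rewrite (leq_trans jd)// ltnW// ltnS leq_addr.
have kn : ((j - d)./2 < n)%N.
  by rewrite ltn_half_double -mul2n ltn_subLR.
rewrite (bigD1 (Ordinal kn))//= big1 ?addr0; last first.
  move=> k; rewrite -val_eqE /= => kj.
  rewrite !yE ?(ltnW (kltn k))//.
  have /negbTE -> : (d + 2 * k).+1 != j.
    apply: contra kj => /eqP <-.
    by rewrite -addnS addKn mul2n (half_bit_double _ true).
  have /negbTE -> : (d + 2 * k)%N != j.
    by apply: contra kj => /eqP <-; rewrite addKn mul2n doubleK.
  by rewrite !mulr0 subrr mulr0.
have := kltn (Ordinal kn); move: (yE (d + 2 * (j - d)./2)%N) (yE (d + 2 * (j - d)./2).+1%N).
rewrite /= => y0 y1 lt1; rewrite y0 ?y1 ?(ltnW lt1)//.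
have jE : j = (d + (odd (j - d) + 2 * (j - d)./2))%N :> nat.
  by rewrite (mul2n (_./2)) odd_double_half subnKC.
case: (odd (j - d)) jE; rewrite ?add1n ?add0n ?addnS => /esym jE.
  rewrite jE eqxx ltn_eqF -?[X in (_ < X)%N]jE//.
  by rewrite mulr0 subr0 !mulrN (mulrC 2^-1) mulrAC.
rewrite jE eqxx gtn_eqF//.
by rewrite mulr0 sub0r !mulrN opprK (mulrC 2^-1) mulrAC (mulrC x`_(_).+1).
Qed.

End corank1.
Arguments lebesgue_heis R d n : clear implicits.
Arguments lebesgue_base R d n : clear implicits.

Definition LW_const (R : realType) (d n : nat) (alpha : n.-tuple R) : \bar R :=
  (radon_norm R `^ (3 / (d + 2 * n + 1)%:R) /
   ((\prod_(k < n) tnth alpha k) `^ (n * (d + 2 * n + 1))%:R^-1)%:E)%E.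

(* Main.v *)
From HB Require Import structures.
Require Import Defs.
From mathcomp Require Import all_boot all_order all_algebra.
From mathcomp Require Import all_classical all_reals all_analysis measurable_realfun.
From mathcomp Require Import ring lra zify.
Import Order.TTheory GRing.Theory Num.Theory.
Import numFieldNormedType.Exports.

Set Implicit Arguments.
Unset Strict Implicit.
Unset Printing Implicit Defensive.

Local Open Scope classical_set_scope.
Local Open Scope ring_scope.

(** Write N = d + 2 n, let p_j be the exponent of f_j, w_j = 1 / p_j and
    g_j = f_j ^ p_j. The inequality becomes
      int prod_j g_j(pi_j) ^ w_j <= C prod_j (int g_j) ^ w_j,
    in which every use of Hölder's inequality is bookkeeping on weights
    ([hoelder_prod]).

    Averaging. The vector w is the mean over k of the vectors w^(k) which give
    2 / (N + 1) to the two coordinates of the k-th symplectic pair and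
    1 / (N + 1) to all the others ([LW_weight_mean]). By Hölder with the n
    equal weights 1 / n it suffices to prove, for each k, the inequality with
    the weights w^(k) and the constant (||R||^3 / alpha_k) ^ (1 / (N + 1)); the
    geometric mean of these constants is C ([LW_const_prod]).

    One pair. For a fixed k, the projections outside the pair may be replaced
    by (x, t) |-> (x without x_j, t + S_j(x)) with arbitrary measurable shears
    S_j ([pair_inequality]). This class is stable under freezing a coordinate,
    so that the coordinates outside the pair can be removed one at a time as in
    the proof of the classical Loomis-Whitney inequality: freeze x_i; the i-th
    projection then acts on the remaining variables as a shear, which preserves
    Lebesgue measure; apply Hölder in the remaining variables, the inequality
    with one coordinate less, and Hölder in x_i ([pair_inequalityS]).

    Two coordinates. After a translation in t, the integral is
      int G2(x, t) ^ (2/3) (int G1(y, t + a x y) ^ (2/3) dy) dx dt.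
    The inner integral is taken over the line of slope a x and intercept t. By
    Hölder it remains to bound the L^3 norm, in slope and intercept, of the
    integrals of h = G1 ^ (2/3) over lines by the L^(3/2) norm of h
    ([planar_loomis_whitney]).

    Radon transform. Put x = - ncot theta. The line of slope x and intercept
    s / sin theta is the line <p, (cos theta, sin theta)> = s, and the Jacobians
    of the three changes of variables (on the line, in s and in theta) cancel
    exactly at the exponent 3, so that the L^3 norm in slope and intercept is
    that of the Radon transform on half of the circle ([ge0_xray_le_radon]).

    Finally a Lebesgue measurable function has a Borel majorant with the same
    norms ([borel_majorant]), which reduces everything to Borel functions. *)

(** * Products of powers and the weighted Hölder inequality *)

Section ereal_powers.
Context (R : realType).
Local Open Scope ereal_scope.
Implicit Types r s : R.

Lemma poweR_addr (x : \bar R) r s : 0 <= x -> (0 <= r)%R -> (0 <= s)%R ->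
  x `^ (r + s) = x `^ r * x `^ s.
Proof.
move=> x0 r0 s0; have [->|xn0] := eqVneq x 0; last first.
  by apply: poweRD; exact: nneg_neq0_poweRD_def.
have [->|r1] := eqVneq r 0%R; first by rewrite add0r poweRe0 mul1e.
have [->|s1] := eqVneq s 0%R; first by rewrite addr0 poweRe0 mule1.
by rewrite !poweR0r ?mul0e// paddr_eq0// (negbTE r1).
Qed.

Lemma poweR_sum (I : Type) (l : seq I) (P : pred I) (x : \bar R) (r : I -> R) :
  0 <= x -> (forall i, 0 <= r i)%R ->
  x `^ (\sum_(i <- l | P i) r i) = \prod_(i <- l | P i) x `^ r i.
Proof.
move=> x0 r0; suff [] : (0 <= \sum_(i <- l | P i) r i)%R /\
  x `^ (\sum_(i <- l | P i) r i) = \prod_(i <- l | P i) x `^ r i by [].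
elim/big_rec2: _ => [|i y1 y2 _ [y10 IH]]; first by rewrite poweRe0.
by split; [rewrite addr_ge0|rewrite poweR_addr ?IH].
Qed.

Lemma prode_poweR (I : Type) (l : seq I) (P : pred I) (x : I -> \bar R) r :
  (forall i, 0 <= x i) ->
  (\prod_(i <- l | P i) x i) `^ r = \prod_(i <- l | P i) x i `^ r.
Proof.
move=> x0; suff [] : 0 <= \prod_(i <- l | P i) x i /\
  (\prod_(i <- l | P i) x i) `^ r = \prod_(i <- l | P i) x i `^ r by [].
elim/big_rec2: _ => [|i y1 y2 _ [y10 IH]]; first by rewrite poweR1r.
by split; [rewrite mule_ge0|rewrite poweRM ?IH].
Qed.

Lemma lee_prod_nneg (I : Type) (l : seq I) (P : pred I) (x y : I -> \bar R) :
  (forall i, P i -> 0 <= x i <= y i) ->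
  \prod_(i <- l | P i) x i <= \prod_(i <- l | P i) y i.
Proof.
move=> xy; suff /andP[] : 0 <= \prod_(i <- l | P i) x i <=
  \prod_(i <- l | P i) y i by [].
elim/big_rec2: _ => [|i a b Pi /andP[a0 ab]]; first by rewrite lee01 lexx.
have /andP[x0 xi] := xy _ Pi.
by rewrite mule_ge0//= lee_pmul.
Qed.

Lemma emeasurable_prod d (T : measurableType d) (D : set T) (I : Type)
    (l : seq I) (P : pred I) (F : I -> T -> \bar R) :
  (forall i, measurable_fun D (F i)) ->
  measurable_fun D (fun x => \prod_(i <- l | P i) F i x).
Proof.
move=> mF; elim: l => [|i l IH].
  by under eq_fun do rewrite big_nil; exact: measurable_cst.
under eq_fun do rewrite big_cons; case: (P i) => //.
exact: emeasurable_funM.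
Qed.

Lemma emeasurable_poweR d (T : measurableType d) (D : set T) r
    (F : T -> \bar R) : measurable_fun D F ->
  measurable_fun D (fun x => F x `^ r).
Proof.
move=> mF; apply: (@measurableT_comp _ _ _ _ _ _ (fun x => x `^ r)) => //.
exact: measurable_poweR.
Qed.

End ereal_powers.

Section hoelder_weights.
Context (R : realType).

(** Weighted AM-GM. With A the weighted mean of the a_i, one has
    a_i / A <= exp (a_i / A - 1), and the exponents w_i (a_i / A - 1) add up to
    0. *)
Lemma prod_powR_le_sum (I : finType) (w a : I -> R) :
  (forall i, 0 <= w i) -> (forall i, 0 <= a i) -> \sum_i w i = 1 ->
  \prod_i a i `^ w i <= \sum_i w i * a i.
Proof.
move=> w0 a0 w1; set A := \sum_i _.
have A0 : 0 <= A by apply: sumr_ge0 => i _; rewrite mulr_ge0.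
have := A0; rewrite le_eqVlt => /predU1P[/esym A_eq0|Agt0].
  have wa i : w i * a i = 0.
    by move/psumr_eq0P : A_eq0; apply=> // j _; rewrite mulr_ge0.
  have [i wi] : exists i, w i != 0.
    apply/existsP; rewrite -negb_forall; apply/negP => /forallP wi.
    by move: w1; rewrite big1 => [/esym/eqP|i _]; [rewrite oner_eq0|apply/eqP].
  have ai : a i = 0.
    by apply/eqP; have /eqP := wa i; rewrite mulf_eq0 (negbTE wi).
  by rewrite (bigD1 i)//= ai powR0// mul0r.
have -> : \prod_i a i `^ w i = A * \prod_i (a i / A) `^ w i.
  have -> : \prod_i (a i / A) `^ w i = \prod_i a i `^ w i * \prod_i A^-1 `^ w i.
    rewrite -big_split/=; apply: eq_bigr => i _.
    by rewrite powRM ?invr_ge0.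
  suff -> : \prod_i A^-1 `^ w i = A^-1 by rewrite mulrCA mulfV ?mulr1// gt_eqF.
  transitivity (A^-1 `^ \sum_i w i); last by rewrite w1 powRr1 ?invr_ge0.
  by rewrite /powR gt_eqF ?invr_gt0// mulr_suml expR_sum.
rewrite ler_piMr//.
rewrite (@le_trans _ _ (expR (\sum_i w i * (a i / A - 1))))//; last first.
  under eq_bigr do rewrite mulrBr mulr1 mulrA.
  by rewrite sumrB w1 -mulr_suml -/A mulfV ?gt_eqF// subrr expR0.
rewrite expR_sum; apply: ler_prod => i _; rewrite powR_ge0/=.
rewrite (mulrC (w i)) expRM ge0_ler_powR ?nnegrE ?expR_ge0 ?divr_ge0//.
by have := expR_ge1Dx (a i / A - 1); rewrite addrC subrK.
Qed.

Local Open Scope ereal_scope.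

Lemma prode_poweR_le_sum (I : finType) (w : I -> R) (a : I -> \bar R) :
  (forall i, 0 < w i)%R -> (forall i, 0 <= a i) -> (\sum_i w i = 1)%R ->
  \prod_i a i `^ w i <= \sum_i (w i)%:E * a i.
Proof.
move=> w0 a0 w1; have wa i : 0 <= (w i)%:E * a i.
  by rewrite mule_ge0// lee_fin ltW.
have [/existsP[i /eqP ai]|] := boolP [exists i, a i == +oo].
  rewrite (bigD1 i)//= [leRHS](bigD1 i)//= ai gt0_muley ?lte_fin//.
  by rewrite addye ?leey// gt_eqF// (lt_le_trans (ltNyr 0%R))// sume_ge0.
rewrite negb_exists => /forallP aoo.
have afin i : a i = (fine (a i))%:E.
  by rewrite fineK// ge0_fin_numE// ltey aoo.
under eq_bigr do rewrite afin poweR_EFin.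
under [leRHS]eq_bigr do rewrite afin -EFinM.
rewrite sumEFin prodEFin lee_fin; apply: prod_powR_le_sum => // i.
  exact: ltW.
exact: fine_ge0.
Qed.

Context d (T : measurableType d) (mu : {measure set T -> \bar R}).

(** Hölder's inequality for finitely many factors. When all the integrals are
    positive and finite, weighted AM-GM is integrated for the functions F_i
    divided by their integrals. If some F_i has integral 0, the product vanishes
    almost everywhere; otherwise, if some integral is infinite, so is the
    right-hand side. *)
Lemma hoelder_prod (I : finType) (w : I -> R) (F : I -> T -> \bar R) :
  (forall i, 0 < w i)%R -> (\sum_i w i = 1)%R ->
  (forall i, measurable_fun setT (F i)) -> (forall i x, 0 <= F i x) ->
  \int[mu]_x \prod_i F i x `^ w i <= \prod_i (\int[mu]_x F i x) `^ w i.
Proof.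
move=> w0 w1 mF F0.
have IF0 i : 0 <= \int[mu]_x F i x by exact: integral_ge0.
have mP : measurable_fun setT (fun x => \prod_i F i x `^ w i).
  by apply: emeasurable_prod => i; exact: emeasurable_poweR.
have P0 x : 0 <= \prod_i F i x `^ w i.
  by apply: prode_ge0 => i _; exact: poweR_ge0.
have [/existsP[i /eqP Ii]|] := boolP [exists i, \int[mu]_x F i x == 0].
  rewrite [leLHS](_ : _ = 0); first by apply: prode_ge0 => j _; exact: poweR_ge0.
  have /ae_eq_integral_abs : \int[mu]_x `|F i x| = 0.
    by under eq_integral do rewrite gee0_abs//.
  move=> /(_ measurableT (mF i)) Fi.
  rewrite (ae_eq_integral (cst 0))//; first by rewrite integral0.
  apply: filterS Fi => x /= + _ => /(_ Logic.I) Fi.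
  by rewrite (bigD1 i)//= Fi poweR0r ?mul0e// gt_eqF.
rewrite negb_exists => /forallP In0.
have Ipos i : 0 < \int[mu]_x F i x by rewrite lt0e In0/=.
have [/existsP[i /eqP Ii]|] := boolP [exists i, \int[mu]_x F i x == +oo].
  rewrite [leRHS](_ : _ = +oo) ?leey// (bigD1 i)//= Ii poweRyr ?gt_eqF//.
  rewrite gt0_mulye//; elim/big_ind: _ => // [x y|j _]; first exact: mule_gt0.
  by rewrite poweR_gt0.
rewrite negb_exists => /forallP Iny.
have Ifin i : \int[mu]_x F i x \is a fin_num.
  by rewrite ge0_fin_numE// ltey.
pose c i : R := fine (\int[mu]_x F i x).
have c0 i : (0 < c i)%R by rewrite fine_gt0// Ipos/= ltey.
have cE i : \int[mu]_x F i x = (c i)%:E by rewrite fineK.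
pose G i x := (c i)^-1%:E * F i x.
have G0 i x : 0 <= G i x by rewrite mule_ge0// lee_fin invr_ge0 ltW.
have mG i : measurable_fun setT (G i) by exact: measurable_funeM.
have FE i x : F i x = (c i)%:E * G i x.
  by rewrite muleA -EFinM mulfV ?mul1e// gt_eqF.
have C0 : 0 <= \prod_i (c i)%:E `^ w i.
  by apply: prode_ge0 => i _; exact: poweR_ge0.
have mQ : measurable_fun setT (fun x => \prod_i G i x `^ w i).
  by apply: emeasurable_prod => i; exact: emeasurable_poweR.
under eq_integral => x _.
  under eq_bigr => i _ do rewrite FE poweRM ?lee_fin ?(ltW (c0 i))//.
  rewrite big_split/=; over.
rewrite ge0_integralZl//; last first.
  by move=> x _; apply: prode_ge0 => i _; exact: poweR_ge0.
under [leRHS]eq_bigr do rewrite cE.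
rewrite -[leRHS]mule1; apply: lee_wpmul2l => //.
apply: (@le_trans _ _ (\int[mu]_x \sum_i (w i)%:E * G i x)).
  apply: ge0_le_integral => //.
  - by move=> x _; apply: prode_ge0 => i _; exact: poweR_ge0.
  - by apply: emeasurable_sum => i; exact: measurable_funeM.
  - by move=> x _; exact: prode_poweR_le_sum.
rewrite ge0_integral_sum//; last 2 first.
- by move=> i; exact: measurable_funeM.
- by move=> i x _; rewrite mule_ge0// lee_fin ltW.
rewrite (eq_bigr (fun i => (w i)%:E)) ?sumEFin ?w1// => i _.
rewrite ge0_integralZl ?lee_fin ?(ltW (w0 i))//.
rewrite ge0_integralZl ?lee_fin ?invr_ge0 ?(ltW (c0 i))//.
by rewrite cE -EFinM mulVf ?mulr1 ?mule1 ?gt_eqF.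
Qed.

Lemma hoelder_weight2 (r s : R) (F G : T -> \bar R) :
  (0 < r)%R -> (0 < s)%R -> (r + s = 1)%R ->
  measurable_fun setT F -> measurable_fun setT G ->
  (forall x, 0 <= F x) -> (forall x, 0 <= G x) ->
  \int[mu]_x (F x `^ r * G x `^ s) <=
  (\int[mu]_x F x) `^ r * (\int[mu]_x G x) `^ s.
Proof.
move=> r0 s0 rs mF mG F0 G0.
have := @hoelder_prod bool (fun b => if b then r else s)
  (fun b => if b then F else G).
rewrite /= !big_bool => /=; under eq_integral do rewrite big_bool.
by apply=> [[]|//|[]|[]].
Qed.

End hoelder_weights.

(** * Affine changes of variables and shears *)

Section sigma_finite_product.
Local Open Scope ereal_scope.
Context d1 d2 (T1 : measurableType d1) (T2 : measurableType d2) (R : realType).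
Variable m1 : {sigma_finite_measure set T1 -> \bar R}.
Variable m2 : {sigma_finite_measure set T2 -> \bar R}.

Lemma sigma_finite_product_measure1 : sigma_finite setT (m1 \x m2).
Proof.
have /sigma_finiteP[F [TF ndF Foo]] := sigma_finiteT m1.
have /sigma_finiteP[G [TG ndG Goo]] := sigma_finiteT m2.
exists (fun n => F n `*` G n).
  apply/esym; rewrite -subTset => -[x y] _.
  have [i _ Fi] : (\bigcup_i F i) x by rewrite -TF.
  have [j _ Gj] : (\bigcup_i G i) y by rewrite -TG.
  exists (maxn i j) => //; split => /=.
    by move: Fi; exact/subsetPset/ndF/leq_maxl.
  by move: Gj; exact/subsetPset/ndG/leq_maxr.
move=> k; have [mF Fk] := Foo k; have [mG Gk] := Goo k.
split; first exact: measurableX.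
by rewrite product_measure1E// lte_mul_pinfty// ge0_fin_numE.
Qed.

(** The product measure bundled with its sigma-finiteness, so that it can be a
    factor of a further product. *)
Definition sigma_finite_prod : {sigma_finite_measure set (T1 * T2)%type -> \bar R} :=
  HB.pack_for {sigma_finite_measure set (T1 * T2)%type -> \bar R} (m1 \x m2)
    (Measure_isSigmaFinite.Build _ _ _ (m1 \x m2) sigma_finite_product_measure1).

End sigma_finite_product.

Section affine.
Context (R : realType).
Local Notation mR := (measurableTypeR R).
Local Notation leb := (@lebesgue_measure R).
Local Open Scope ereal_scope.

Lemma measurable_affine (a b : R) :
  measurable_fun [set: mR] (fun u : mR => (a * u + b)%R : mR).
Proof. by apply: measurable_funD => //; exact: measurable_funM. Qed.

Section affine_measure.
Context (a b : R) (a0 : a != 0%R).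

(** It suffices to compare the two measures on the intervals ]c, d], whose
    preimages are intervals of length (d - c) / |a|. *)
Lemma lebesgue_measure_affine (A : set mR) : measurable A ->
  leb A = `|a|%:E * leb ((fun u : mR => (a * u + b)%R : mR) @^-1` A).
Proof.
pose mu := mscale (NngNum (normr_ge0 a))
  (measure_function_pushforward__canonical__measure_function_Measure
     leb (measurable_affine a b)).
move=> mA; apply: (@lebesgue_measure_unique R mu _ A mA) => _ [[c d]] _ <-.
transitivity (`|a|%:E *
  leb ((fun u : mR => (a * u + b)%R : mR) @^-1` `]c, d]%classic)); last by [].
have [a_gt0|a_lt0|/eqP] := ltgtP a 0%R; last by rewrite (negbTE a0).
- rewrite (_ : _ @^-1` _ = `[((d - b) / a)%R, ((c - b) / a)%R[%classic); last first.
    apply/seteqP; split=> u /=; rewrite !in_itv/= ler_ndivrMr// ltr_ndivlMr//.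
      by rewrite ltrBlDr lerBrDr mulrC andbC.
    by rewrite ltrBlDr lerBrDr mulrC andbC.
  rewrite !lebesgue_measure_itv/= !lte_fin.
  rewrite ltr_nM2r ?invr_lt0// ltrD2r.
  case: ifPn => _; last by rewrite mule0.
  rewrite ltr0_norm// -!EFinB -EFinM; congr EFin.
  by field.
- rewrite (_ : _ @^-1` _ = `]((c - b) / a)%R, ((d - b) / a)%R]%classic); last first.
    apply/seteqP; split=> u /=; rewrite !in_itv/= ler_pdivlMr// ltr_pdivrMr//.
      by rewrite ltrBlDr lerBrDr mulrC.
    by rewrite ltrBlDr lerBrDr mulrC.
  rewrite !lebesgue_measure_itv/= !lte_fin.
  rewrite ltr_pM2r ?invr_gt0// ltrD2r.
  case: ifPn => _; last by rewrite mule0.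
  rewrite gtr0_norm// -!EFinB -EFinM; congr EFin.
  by field.
Qed.

Lemma ge0_integral_affine (f : mR -> \bar R) :
  measurable_fun setT f -> (forall x, 0 <= f x) ->
  \int[leb]_u f (a * u + b)%R = `|a|^-1%:E * \int[leb]_u f u.
Proof.
move=> mf f0.
pose nu := (measure_function_pushforward__canonical__measure_function_Measure
     leb (measurable_affine a b)).
have -> : \int[leb]_u f u = \int[mscale (NngNum (normr_ge0 a)) nu]_u f u.
  by apply: eq_measure_integral => A mA _; exact: lebesgue_measure_affine.
rewrite ge0_integral_mscale// muleA -EFinM mulVf ?normr_eq0// mul1e.
by rewrite ge0_integral_pushforward//; exact: measurable_affine.
Qed.

End affine_measure.

Lemma ge0_integral_shift (b : R) (f : mR -> \bar R) :
  measurable_fun setT f -> (forall x, 0 <= f x) ->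
  \int[leb]_u f (u + b)%R = \int[leb]_u f u.
Proof.
move=> mf f0; have := @ge0_integral_affine 1%R b (oner_neq0 R) f mf f0.
rewrite normr1 invr1 mul1e => <-.
by under [in RHS]eq_integral do rewrite mul1r.
Qed.

Context d (T : measurableType d) (mu : {sigma_finite_measure set T -> \bar R}).

Lemma measurable_shear (S : T -> mR) : measurable_fun setT S ->
  measurable_fun setT (fun p : T * mR => (p.1, (p.2 + S p.1)%R : mR)).
Proof.
move=> mS; apply: measurable_fun_pair => //=; apply: measurable_funD => //.
exact: measurableT_comp.
Qed.

(** On each line {x} x R the shear is a translation. *)
Lemma ge0_integral_shear (S : T -> mR) (f : T * mR -> \bar R) :
  measurable_fun setT S -> measurable_fun setT f -> (forall x, 0 <= f x) ->
  \int[mu \x leb]_p f (p.1, (p.2 + S p.1)%R) = \int[mu \x leb]_p f p.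
Proof.
move=> mS mf f0.
rewrite (fubini_tonelli1 (fun p : T * mR => f (p.1, (p.2 + S p.1)%R)))//; last first.
  exact: (measurableT_comp mf (measurable_shear mS)).
rewrite (fubini_tonelli1 f)//; apply: eq_integral => x _.
rewrite /fubini_F/=.
by rewrite (ge0_integral_shift (S x) (f := fun t => f (x, t)))//;
  exact: measurableT_comp.
Qed.

End affine.

(** * Inserting a coordinate *)

Section insertion.
Context (R : realType).
Local Notation mR := (measurableTypeR R).
Local Notation leb := (@lebesgue_measure R).

Definition insert_coord n (i : 'I_n.+1) (z : mR) (x : n.-tuple mR) :
    n.+1.-tuple mR :=
  [tuple if unlift i k is Some l then tnth x l else z | k < n.+1].

Lemma tnth_insert n (i : 'I_n.+1) z (x : n.-tuple mR) :
  tnth (insert_coord i z x) i = z.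
Proof. by rewrite tnth_mktuple unlift_none. Qed.

Lemma tnth_insert_lift n (i : 'I_n.+1) z (x : n.-tuple mR) k :
  tnth (insert_coord i z x) (lift i k) = tnth x k.
Proof. by rewrite tnth_mktuple liftK. Qed.

Lemma tnth_del_coord m (j : 'I_m) (x : m.-tuple mR) k :
  tnth (del_coord j x) k = tnth x (lift j k).
Proof. exact: tnth_mktuple. Qed.

Lemma del_coord_insert n (i : 'I_n.+1) z (x : n.-tuple mR) :
  del_coord i (insert_coord i z x) = x.
Proof.
by apply/eq_from_tnth => k; rewrite tnth_del_coord tnth_insert_lift.
Qed.

(** The position i' is that of i once the other position has been deleted; it
    depends on the two positions only. *)
Lemma del_coord_insert_lift n (i : 'I_n.+2) (j : 'I_n.+1) :
  exists i' : 'I_n.+1, forall z (x : n.+1.-tuple mR),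
    del_coord (lift i j) (insert_coord i z x) = insert_coord i' z (del_coord j x).
Proof.
case: (unliftP (lift i j) i) => [i' iE|/eqP]; last first.
  by rewrite (negbTE (neq_lift _ _)).
exists i' => z x; apply/eq_from_tnth => k; rewrite [LHS]tnth_del_coord.
case: (unliftP i' k) => [l|] ->.
  rewrite tnth_insert_lift (tnth_del_coord j x l).
  suff -> : lift (lift i j) (lift i' l) = lift i (lift j l).
    by rewrite tnth_insert_lift.
  apply/val_inj; move/(congr1 val): iE; rewrite /= /bump; lia.
by rewrite tnth_insert -iE tnth_insert.
Qed.

Lemma measurable_insert n (i : 'I_n.+1) :
  measurable_fun setT (fun p : mR * n.-tuple mR => insert_coord i p.1 p.2).
Proof.
apply/measurable_fun_tnthP => k; case: (unliftP i k) => [l|] ->.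
  rewrite (_ : _ \o _ = (fun x => tnth x l) \o snd); last first.
    by apply/funext => -[z x] /=; rewrite tnth_insert_lift.
  apply: measurableT_comp => //; exact: measurable_tnth.
rewrite (_ : _ \o _ = fst)//.
by apply/funext => -[z x] /=; rewrite tnth_insert.
Qed.

Lemma measurable_insert_comp n (i : 'I_n.+1) d (T : measurableType d)
    (f : T -> mR) (g : T -> n.-tuple mR) :
  measurable_fun setT f -> measurable_fun setT g ->
  measurable_fun setT (fun t => insert_coord i (f t) (g t)).
Proof.
move=> mf mg; exact: (measurableT_comp (measurable_insert i)
  (measurable_fun_pair mf mg)).
Qed.

Lemma measurable_del_coord m (j : 'I_m) :
  measurable_fun setT (@del_coord R m j).
Proof.
apply/measurable_fun_tnthP => k.
rewrite (_ : _ \o _ = (fun x => tnth x (lift j k))); first exact: measurable_tnth.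
by apply/funext => x /=; rewrite tnth_del_coord.
Qed.

Local Open Scope ereal_scope.

Let ge0_integral_cons n (F : n.+1.-tuple mR -> \bar R) :
  measurable_fun setT F -> (forall x, 0 <= F x) ->
  \int[lebesgue_Rn R n.+1]_x F x =
  \int[leb]_z \int[lebesgue_Rn R n]_x F (cons_Rn (z, x)).
Proof.
move=> mF F0; have mc := @measurable_cons_Rn R n.
transitivity (\int[leb \x lebesgue_Rn R n]_p (F \o @cons_Rn R n) p).
  transitivity (\int[pushforward (leb \x lebesgue_Rn R n) (@cons_Rn R n)]_x F x).
    by [].
  rewrite (ge0_integral_pushforward mc (leb \x lebesgue_Rn R n))//.
by rewrite fubini_tonelli1//; [exact: (measurableT_comp mF mc)|move=> x; exact: F0].
Qed.

#[local] Opaque lebesgue_Rn.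

(** Fubini's theorem for the coordinate in position i: by induction on the
    dimension, the inserted coordinate is moved past the first one by exchanging
    two integrals. *)
Lemma ge0_integral_insert n (i : 'I_n.+1) (F : n.+1.-tuple mR -> \bar R) :
  measurable_fun setT F -> (forall x, 0 <= F x) ->
  \int[lebesgue_Rn R n.+1]_x F x =
  \int[leb]_z \int[lebesgue_Rn R n]_x F (insert_coord i z x).
Proof.
elim: n i F => [|n IH] i F mF F0.
  rewrite (ge0_integral_cons mF F0); apply: eq_integral => z _.
  apply: eq_integral => x _; congr F; apply/eq_from_tnth => k.
  by rewrite !ord1 tnth_insert.
case: (unliftP ord0 i) => [j ->|->]; last first.
  rewrite (ge0_integral_cons mF F0); apply: eq_integral => z _.
  apply: eq_integral => x _; congr F; apply/eq_from_tnth => k.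
  by case: (unliftP ord0 k) => [l|] ->; rewrite ?tnth_insert ?tnth_insert_lift ?tnthS.
have cons_insert z a (y : n.-tuple mR) :
    insert_coord (lift ord0 j) z (cons_Rn (a, y)) = cons_Rn (a, insert_coord j z y).
  apply/eq_from_tnth => k.
  case: (unliftP ord0 k) => [l ->|->]; last first.
    have e : lift (lift ord0 j) ord0 = ord0 by apply/val_inj.
    by rewrite -[X in tnth (insert_coord _ _ _) X]e tnth_insert_lift.
  rewrite [RHS]tnthS; case: (unliftP j l) => [m|] ->.
    have -> : lift ord0 (lift j m) = lift (lift ord0 j) (lift ord0 m).
      by apply/val_inj; rewrite /= /bump; lia.
    by rewrite !tnth_insert_lift tnthS.
  by rewrite !tnth_insert.
have mFc a : measurable_fun setT (fun y : n.+1.-tuple mR => F (cons_Rn (a, y))).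
  apply: measurableT_comp => //; apply: measurableT_comp => //.
  exact: measurable_cons_Rn.
have mFi z : measurable_fun setT
    (fun y : n.+1.-tuple mR => F (insert_coord (lift ord0 j) z y)).
  apply: measurableT_comp => //.
  exact: (measurableT_comp (measurable_insert (lift ord0 j)) (pair1_measurable z)).
rewrite (ge0_integral_cons mF F0).
under eq_integral do rewrite (IH j)//.
under [RHS]eq_integral do rewrite ge0_integral_cons//.
pose H (p : mR * mR) :=
  \int[lebesgue_Rn R n]_x F (cons_Rn (p.1, insert_coord j p.2 x)).
have mH : measurable_fun setT H.
  apply: (measurable_fun_fubini_tonelli_F
    (fun q : (mR * mR) * n.-tuple mR =>
      F (cons_Rn (q.1.1, insert_coord j q.1.2 q.2)))).
    apply: measurableT_comp => //; apply: measurableT_comp => //.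
      exact: measurable_cons_Rn.
    apply: measurable_fun_pair => /=; first exact: measurableT_comp.
    by apply: measurable_insert_comp => //; exact: measurableT_comp.
  by move=> q; exact: F0.
have H0 p : 0 <= H p by apply: integral_ge0 => x _; exact: F0.
have /= HE := fubini_tonelli (m1 := leb) (m2 := leb) H mH H0.
etransitivity; first exact: HE.
apply: eq_integral => z _; apply: eq_integral => a _.
by apply: eq_integral => x _; rewrite cons_insert.
Qed.

(** The form used to freeze one horizontal coordinate, the vertical coordinate t
    being kept together with the remaining ones. *)
Lemma ge0_integral_insert_prod n (i : 'I_n.+1)
    (F : n.+1.-tuple mR * mR -> \bar R) :
  measurable_fun setT F -> (forall x, 0 <= F x) ->
  \int[lebesgue_Rn R n.+1 \x leb]_p F p =
  \int[leb]_z \int[lebesgue_Rn R n \x leb]_p F (insert_coord i z p.1, p.2).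
Proof.
move=> mF F0; rewrite fubini_tonelli2// /fubini_G.
have mFt t : measurable_fun setT (fun x => F (x, t)) by exact: measurableT_comp.
have mG : measurable_fun setT (fun q : (mR * mR) * n.-tuple mR =>
    F (insert_coord i q.1.2 q.2, q.1.1)).
  apply: measurableT_comp => //; apply: measurable_fun_pair => /=.
    by apply: measurable_insert_comp => //; exact: measurableT_comp.
  exact: measurableT_comp.
under eq_integral do rewrite (ge0_integral_insert i)//.
pose H (q : mR * mR) := \int[lebesgue_Rn R n]_x F (insert_coord i q.2 x, q.1).
have mH : measurable_fun setT H.
  exact: (measurable_fun_fubini_tonelli_F _ mG (fun q => F0 _)).
have H0 q : 0 <= H q by apply: integral_ge0 => x _; exact: F0.
etransitivity; first exact: (fubini_tonelli (m1 := leb) (m2 := leb) H mH H0).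
apply: eq_integral => z _; rewrite /H/=; apply/esym.
apply: (fubini_tonelli2 (m1 := lebesgue_Rn R n) (m2 := leb)
  (fun p : n.-tuple mR * mR => F (insert_coord i z p.1, p.2))); last first.
  by move=> p; exact: F0.
apply: measurableT_comp => //; apply: measurable_fun_pair => //=.
exact: measurable_insert_comp.
Qed.

End insertion.

(** * Arctangent as a change of variables *)

Section restricted_measures.
Local Open Scope ereal_scope.

Lemma ge0_integral_mrestr d (T : measurableType d) (R : realType)
    (mu : {measure set T -> \bar R}) (D : set T) (mD : measurable D)
    (f : T -> \bar R) : measurable_fun setT f -> (forall x, 0 <= f x) ->
  \int[mrestr mu mD]_x f x = \int[mu]_(x in D) f x.
Proof.
move=> mf f0; rewrite -(setUv D) ge0_integral_setU//=; last 3 first.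
- exact: measurableC.
- by rewrite setUv.
- exact/disj_setPCl.
rewrite [X in _ + X](_ : _ = 0) ?adde0; last first.
  rewrite -(integral_measure_zero (T := T) (~` D) f).
  apply: eq_measure_integral => A mA AD /=; rewrite /mrestr/=.
  rewrite (_ : A `&` D = set0) ?measure0//.
  by apply/disjoints_subset.
by apply: eq_measure_integral => A mA AD /=; rewrite /mrestr setIidl.
Qed.

End restricted_measures.

Section arctangent.
Context (R : realType).
Local Notation mR := (measurableTypeR R).
Local Notation leb := (@lebesgue_measure R).
Local Open Scope ereal_scope.

Let atan_nd : nondecreasing (@atan R). Proof. exact: le_atan. Qed.

Let atan_rc : right_continuous (@atan R).
Proof. by apply: right_continuousW => x; exact: continuous_atan. Qed.

HB.instance Definition _ := isCumulative.Build R _ R (@atan R) atan_nd atan_rc.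

Let w (x : R) : R := (1 + x ^+ 2)^-1.

Let w_gt0 x : (0 < w x)%R.
Proof. by rewrite invr_gt0 ltr_pwDl// sqr_ge0. Qed.

Let cw : continuous w.
Proof.
move=> x; apply: cvgV; first by rewrite gt_eqF// ltr_pwDl// sqr_ge0.
by apply: cvgD; [exact: cvg_cst|exact: exprn_continuous].
Qed.

Let mw : measurable_fun setT w. Proof. exact: continuous_measurable_fun. Qed.

(* The measure w(x) dx is the first marginal of planar Lebesgue measure on the
   region under the graph of w. *)
Let region : set (mR * mR) := [set p | (0 <= p.2)%R] `&` [set p | (p.2 <= w p.1)%R].

Let mregion : measurable region.
Proof.
apply: measurableI; rewrite -[X in measurable X]setTI;
  apply: measurable_fun_le => //.
exact: measurableT_comp.
Qed.

Let density := measure_function_pushforward__canonical__measure_function_Measure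
  (mrestr (leb \x leb) mregion) (@measurable_fst _ _ mR mR).

Let integral_density (f : mR -> \bar R) :
  measurable_fun setT f -> (forall x, 0 <= f x) ->
  \int[density]_x f x = \int[leb]_x (f x * (w x)%:E).
Proof.
move=> mf f0.
transitivity (\int[pushforward (mrestr (leb \x leb) mregion) fst]_x f x) => //.
rewrite ge0_integral_pushforward// preimage_setT.
rewrite ge0_integral_mrestr; [|exact: measurableT_comp|by move=> ?; exact: f0].
rewrite integral_mkcond fubini_tonelli1; last 2 first.
- apply: (measurable_restrictT _ mregion).1; apply: (measurableT_comp mf).
  exact: measurable_funTS.
- by move=> p; rewrite patchE; case: ifPn => //=.
apply: eq_integral => x _; rewrite /fubini_F.
transitivity (\int[leb]_(u in `[0%R, w x]) cst (f x) u).
  rewrite [RHS]integral_mkcond; apply: eq_integral => u _; rewrite !patchE/=.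
  congr (if _ then _ else _).
  by apply/idP/idP; rewrite !inE/= in_itv/= => /andP.
rewrite integral_cst//= lebesgue_measure_itv/= lte_fin w_gt0.
by rewrite -EFinB subr0.
Qed.

Let density_itv (a b : R) : (a < b)%R ->
  density `]a, b]%classic = (atan b - atan a)%:E.
Proof.
move=> ab; rewrite -[X in density X]setIT -integral_indic//.
rewrite integral_density//; last exact/measurable_EFinP/measurable_indic.
transitivity (\int[leb]_(x in `]a, b]) (w x)%:E).
  rewrite [RHS]integral_mkcond; apply: eq_integral => x _.
  by rewrite patchE indicE; case: ifP => _; rewrite ?mul1e ?mul0e.
rewrite integral_itv_obnd_cbnd; last first.
  by apply: measurable_funTS; exact/measurable_EFinP.
rewrite (@continuous_FTC2 _ w (@atan R))//.
- by apply: continuous_subspaceT => x; exact: cw.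
- split.
  + by move=> x _; exact: derivable_atan.
  + by apply: cvg_at_right_filter; exact: continuous_atan.
  + by apply: cvg_at_left_filter; exact: continuous_atan.
- by move=> x _; rewrite derive1_atan.
Qed.

Let stieltjes_atan_itv (a b : R) : (a < b)%R ->
  lebesgue_stieltjes_measure (@atan R) `]a, b]%classic = (atan b - atan a)%:E.
Proof.
move=> ab; rewrite /lebesgue_stieltjes_measure/= /measure_extension.
rewrite measurable_mu_extE//=; last exact: is_ocitv.
by rewrite wlength_itv_bnd// ltW.
Qed.

Let stieltjes_atanE (nu : {measure set mR -> \bar R}) :
  (forall a b, (a < b)%R -> nu `]a, b]%classic = (atan b - atan a)%:E) ->
  forall A, measurable A -> lebesgue_stieltjes_measure (@atan R) A = nu A.
Proof.
move=> nuE; apply: lebesgue_stieltjes_measure_unique => A /ocitvP[->|].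
  by rewrite !measure0.
by move=> [[a b]/= ab ->]; rewrite nuE// stieltjes_atan_itv.
Qed.

Let arc : set mR := `]0%R, (pi : R)[%classic.
Let marc : measurable arc. Proof. exact: measurable_itv. Qed.

(* On ]0, pi[ this is - cot, the inverse of atan + pi / 2. *)
Let ncot : mR -> mR := (fun theta : R => tan (theta - pi / 2)) \_ arc.

Let mncot : measurable_fun setT ncot.
Proof.
apply: (measurable_restrictT _ marc).1.
apply: open_continuous_measurable_fun; first exact: interval_open.
move=> x /set_mem; rewrite /arc/= in_itv/= => /andP[x0 xpi].
apply: (@continuous_comp _ _ _ (fun y : R => y - pi / 2)%R (@tan R)).
  by apply: cvgB; [exact: cvg_id|exact: cvg_cst].
apply: continuous_tan; apply/lt0r_neq0/cos_gt0_pihalf.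
by apply/andP; split; lra.
Qed.

Let ncotK theta : arc theta -> (atan (ncot theta) + pi / 2 = theta)%R.
Proof.
move=> atheta; rewrite /ncot patchE mem_set// tanK ?subrK//.
by move: atheta; rewrite /arc/= !in_itv/= => /andP[x0 xpi]; apply/andP; split; lra.
Qed.

Let image := measure_function_pushforward__canonical__measure_function_Measure
  (mrestr leb marc) mncot.

Let image_itv (a b : R) : (a < b)%R ->
  image `]a, b]%classic = (atan b - atan a)%:E.
Proof.
move=> ab; transitivity (leb (ncot @^-1` `]a, b]%classic `&` arc)) => //.
rewrite (_ : _ `&` _ = `](atan a + pi / 2)%R, (atan b + pi / 2)%R]%classic).
  rewrite lebesgue_measure_itv/= lte_fin ltrD2r lt_atan//.
  by rewrite -EFinB; congr EFin; lra.
have altb (c : R) theta : arc theta ->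
    (c < ncot theta)%R = (atan c + pi / 2 < theta)%R.
  move=> at_; rewrite -[in RHS](ncotK at_) ltrD2r; apply/idP/idP; first exact: lt_atan.
  by apply: contraTT; rewrite -!leNgt; exact: le_atan.
apply/seteqP; split=> theta /=.
  move=> [+ at_]; rewrite !in_itv/= altb// => /andP[-> cb] /=.
  by rewrite -[leLHS](ncotK at_) lerD2r le_atan.
rewrite !in_itv/= => /andP[ta tb].
have at_ : arc theta.
  have := atan_gtNpi2 a; have := atan_ltpi2 b.
  by rewrite /arc/= in_itv/= => ? ?; apply/andP; split; lra.
split=> //; rewrite altb// ta/= leNgt altb// -leNgt//.
Qed.

(** The image under - cot of the length on ]0, pi[, and the measure
    dx / (1 + x^2), both give mass atan b - atan a to ]a, b]: they are the
    Stieltjes measure of atan. *)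
Lemma ge0_integral_atan (f : mR -> \bar R) :
  measurable_fun setT f -> (forall x, 0 <= f x) ->
  \int[leb]_(theta in `]0%R, (pi : R)[) f theta =
  \int[leb]_x (f (atan x + pi / 2)%R * ((1 + x ^+ 2)^-1)%:E).
Proof.
move=> mf f0.
have mfa : measurable_fun setT (fun x : mR => f (atan x + pi / 2)%R).
  apply: (measurableT_comp mf); apply: measurable_funD => //.
  by apply: continuous_measurable_fun => x; exact: continuous_atan.
rewrite -(integral_density mfa)//.
transitivity (\int[image]_x f (atan x + pi / 2)%R); last first.
  apply: eq_measure_integral => A mA _.
  by rewrite -(stieltjes_atanE image_itv)// (stieltjes_atanE density_itv).
transitivity (\int[pushforward (mrestr leb marc) ncot]_x f (atan x + pi / 2)%R) => //.
rewrite ge0_integral_pushforward// preimage_setT.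
rewrite ge0_integral_mrestr; [|exact: measurableT_comp|by move=> ?; exact: f0].
by apply: eq_integral => theta /set_mem at_ /=; rewrite ncotK.
Qed.

End arctangent.

(** * The Radon transform in slope and intercept coordinates *)

Section radon.
Context (R : realType).
Local Notation mR := (measurableTypeR R).
Local Notation leb := (@lebesgue_measure R).
Local Open Scope ereal_scope.

Lemma integral_poweR_eq0 d (T : measurableType d) (mu : {measure set T -> \bar R})
    (f : T -> \bar R) (r : R) : measurable_fun setT f -> (forall x, 0 <= f x) ->
  r != 0%R -> \int[mu]_x f x = 0 -> \int[mu]_x f x `^ r = 0.
Proof.
move=> mf f0 r0 If.
have /ae_eq_integral_abs : \int[mu]_x `|f x| = 0.
  by under eq_integral do rewrite gee0_abs//.
move=> /(_ measurableT mf) fae.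
rewrite (ae_eq_integral (cst 0))//; first by rewrite integral0.
  exact: emeasurable_poweR.
by apply: filterS fae => x /= + _ => /(_ Logic.I) ->; rewrite poweR0r.
Qed.

(** The integral of h over the line of slope p.1 and intercept p.2, with respect
    to the abscissa y instead of arc length. *)
Definition xray (h : mR * mR -> \bar R) (p : mR * mR) : \bar R :=
  \int[leb]_y h (y, (p.2 + p.1 * y)%R).

Lemma xray_ge0 h p : (forall q, 0 <= h q) -> 0 <= xray h p.
Proof. by move=> h0; apply: integral_ge0. Qed.

Lemma measurable_xray h : measurable_fun setT h -> (forall q, 0 <= h q) ->
  measurable_fun setT (xray h).
Proof.
move=> mh h0; apply: (measurable_fun_fubini_tonelli_F
  (fun q : (mR * mR) * mR => h (q.2, (q.1.2 + q.1.1 * q.2)%R))) => //.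
apply: (measurableT_comp mh); apply: measurable_fun_pair => //=.
apply: measurable_funD; first exact: measurableT_comp.
by apply: measurable_funM => //; exact: measurableT_comp.
Qed.

Lemma measurable_line_param (h : mR * mR -> R) : measurable_fun setT h ->
  measurable_fun setT (fun q : (mR * mR * mR) * mR =>
    (h ((q.1.2 * q.1.1.1 - q.2 * q.1.1.2)%R,
        (q.1.2 * q.1.1.2 + q.2 * q.1.1.1)%R))%:E).
Proof.
move=> mh; apply/measurable_EFinP; apply: (measurableT_comp mh).
have m1 : measurable_fun setT (fun q : (mR * mR * mR) * mR => q.1.2 : mR).
  exact: measurableT_comp.
have m2 : measurable_fun setT (fun q : (mR * mR * mR) * mR => q.1.1.1 : mR).
  by do 2 apply: measurableT_comp => //.
have m3 : measurable_fun setT (fun q : (mR * mR * mR) * mR => q.1.1.2 : mR).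
  by do 2 apply: measurableT_comp => //.
by apply: measurable_fun_pair => /=;
  [apply: measurable_funB|apply: measurable_funD]; exact: measurable_funM.
Qed.

Lemma measurable_radon (h : mR * mR -> R) : measurable_fun setT h ->
  (forall q, (0 <= h q)%R) -> measurable_fun setT (radon h).
Proof.
move=> mh h0; have mg := measurable_line_param mh.
rewrite (_ : radon h = fun p => \int[leb]_u (h
  ((p.2 * p.1.1 - u * p.1.2)%R, (p.2 * p.1.2 + u * p.1.1)%R))%:E); last first.
  by apply/funext => -[].
apply: (measurable_fun_fubini_tonelli_F _ mg).
by move=> q; rewrite lee_fin.
Qed.

(* This is sin theta for theta = atan x + pi / 2, while
   cos theta = - (x * w x). *)
Let w (x : R) : R := (Num.sqrt (1 + x ^+ 2))^-1%R.

Let w_gt0 x : (0 < w x)%R.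
Proof. by rewrite invr_gt0 sqrtr_gt0 ltr_pwDl// sqr_ge0. Qed.

Let w2 x : (w x ^+ 2 * (1 + x ^+ 2) = 1)%R.
Proof.
rewrite /w exprVn sqr_sqrtr ?mulVf//; last by rewrite addr_ge0// sqr_ge0.
by rewrite gt_eqF// ltr_pwDl// sqr_ge0.
Qed.

(** For theta = atan x + pi / 2, the line <p, (cos theta, sin theta)> = s has
    slope x and intercept s / w x. Its abscissa is an affine function of the arc
    length u, with slope - w x. *)
Lemma radon_xray (h : mR * mR -> R) (x s : R) : measurable_fun setT h ->
  (forall q, (0 <= h q)%R) ->
  radon h (circle_param (atan x + pi / 2)%R, s) =
  (w x)^-1%:E * xray (EFin \o h) (x, (s / w x)%R).
Proof.
move=> mh h0; have wx0 := w_gt0 x.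
have cosE : cos (atan x + pi / 2)%R = (- (x * w x))%R.
  rewrite cosDpihalf; congr (- _)%R.
  have cn0 : cos (atan x) != 0%R by rewrite cos_atan gt_eqF.
  by rewrite -[LHS](divfK cn0) -/(tan (atan x)) atanK cos_atan.
have sinE : sin (atan x + pi / 2)%R = w x by rewrite sinDpihalf cos_atan.
rewrite /radon/= cosE sinE.
have /= := @ge0_integral_affine R (- w x) (- (s * x * w x)) _
  (fun y => (h (y, (s / w x + x * y)%R))%:E).
rewrite normrN gtr0_norm// => <-.
- apply: eq_integral => u _; congr (h (_, _))%:E.
    by rewrite addrC; ring.
  have sE : (s = s / w x * w x)%R by rewrite divfK// gt_eqF.
  have := congr1 ( *%R (s / w x))%R (w2 x); rewrite mulr1.
  by move: sE; set k := (s / w x)%R => -> ?; lra.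
- by rewrite oppr_eq0 gt_eqF.
- apply/measurable_EFinP; apply: (measurableT_comp mh).
  apply: measurable_fun_pair => //; apply: measurable_funD => //.
- by move=> y; rewrite lee_fin.
Qed.

End radon.

Section arc_integrals.
Context (R : realType).
Local Notation mR := (measurableTypeR R).
Local Notation leb := (@lebesgue_measure R).
Local Open Scope ereal_scope.

Lemma ge0_integral_arc_length (f : mR * mR -> \bar R) :
  measurable_fun setT f -> (forall x, 0 <= f x) ->
  \int[arc_length R]_x f x =
  \int[leb]_(theta in `[0%R, (2 * pi : R)%R[) f (circle_param theta).
Proof.
move=> mf f0.
transitivity (\int[pushforward (mrestr leb (@measurable_turn R))
  (@circle_param R)]_x f x) => //.
rewrite (ge0_integral_pushforward (@measurable_circle_param R))// preimage_setT.
rewrite ge0_integral_mrestr//; [|by move=> ?; exact: f0].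
exact: (measurableT_comp mf (@measurable_circle_param R)).
Qed.

Let arc_length_sigma_finite : sigma_finite setT (arc_length R).
Proof.
exists (fun=> setT); first by rewrite bigcup_const.
move=> _; split => //; rewrite /arc_length /pushforward preimage_setT /mrestr setTI.
rewrite lebesgue_measure_itv/=; case: ifP => _ //.
by rewrite -EFinB ltry.
Qed.

HB.instance Definition _ := Measure_isSigmaFinite.Build _ _ _ (arc_length R)
  arc_length_sigma_finite.

(** Only the half circle 0 < theta < pi is kept, on which every line of finite
    slope occurs exactly once. *)
Lemma ge0_integral_arc_lebesgue (f : mR * mR * mR -> \bar R) :
  measurable_fun setT f -> (forall x, 0 <= f x) ->
  \int[leb]_x (\int[leb]_s f (circle_param (atan x + pi / 2)%R, s) *
    ((1 + x ^+ 2)^-1)%:E) <= \int[arc_lebesgue R]_p f p.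
Proof.
move=> mf f0.
have mF := measurable_fun_fubini_tonelli_F (m2 := leb) f mf f0.
have F0 : forall sigma, 0 <= fubini_F leb f sigma.
  by move=> sigma; apply: integral_ge0.
rewrite (_ : \int[arc_lebesgue R]_p f p = \int[arc_length R \x leb]_p f p)//.
rewrite fubini_tonelli1//.
rewrite ge0_integral_arc_length//.
have mFc := measurableT_comp mF (@measurable_circle_param R).
rewrite -(ge0_integral_atan mFc)//; last by move=> ?; exact: F0.
apply: ge0_subset_integral => //=.
- by apply: measurable_funTS; exact: mFc.
- move=> theta; rewrite /= !in_itv/= => /andP[t0 tpi]; rewrite ltW//=.
  by rewrite (lt_trans tpi)// ltr_pMl ?pi_gt0// ltr1n.
Qed.

(** With w = 1 / sqrt (1 + x^2), the cube of the Radon transform contributes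
    w^-3, the change of variable in s contributes w, and the one in theta
    contributes w^2: the exponent 3 is the one for which these cancel. *)
Lemma ge0_xray_le_radon (h : mR * mR -> R) : measurable_fun setT h ->
  (forall q, (0 <= h q)%R) ->
  \int[leb \x leb]_p (xray (EFin \o h) p) `^ 3 <=
  \int[arc_lebesgue R]_p (radon h p) `^ 3.
Proof.
move=> mh h0; have mX : measurable_fun setT (xray (EFin \o h)).
  apply: measurable_xray; first exact/measurable_EFinP.
  by move=> q; rewrite lee_fin.
have X0 p : 0 <= xray (EFin \o h) p.
  by apply: xray_ge0 => q; rewrite lee_fin.
apply: le_trans (ge0_integral_arc_lebesgue _ _); last 2 first.
- by apply: emeasurable_poweR; exact: measurable_radon.
- by move=> p; exact: poweR_ge0.
rewrite fubini_tonelli1; last 2 first.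
- exact: emeasurable_poweR.
- by move=> p; exact: poweR_ge0.
rewrite le_eqVlt; apply/orP; left; apply/eqP; apply: eq_integral => x _.
rewrite /fubini_F.
pose c : R := (Num.sqrt (1 + x ^+ 2))%R.
have x1 : (0 < 1 + x ^+ 2)%R by rewrite ltr_pwDl// sqr_ge0.
have c0 : (0 < c)%R by rewrite sqrtr_gt0.
have c2 : (c ^+ 2 = 1 + x ^+ 2)%R by rewrite sqr_sqrtr// ltW.
pose g s := (xray (EFin \o h) (x, s)) `^ 3.
have mg : measurable_fun setT g.
  by apply: emeasurable_poweR; exact: measurableT_comp.
have g0 s : 0 <= g s by exact: poweR_ge0.
have gE s : (radon h (circle_param (atan x + pi / 2)%R, s)) `^ 3 =
    (c ^+ 3)%:E * g (c * s)%R.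
  rewrite radon_xray// invrK -/c poweRM//; last by rewrite lee_fin ltW.
  by rewrite poweR_EFin powR_mulrn ?ltW// (mulrC c).
under [in RHS]eq_integral do rewrite gE.
rewrite ge0_integralZl//; last 2 first.
- apply: (measurableT_comp mg).
  exact: measurable_funM.
- by rewrite lee_fin exprn_ge0// ltW.
have /= := @ge0_integral_affine R c 0%R _ g mg g0.
under eq_integral do rewrite addr0.
move=> ->; last by rewrite gt_eqF.
rewrite gtr0_norm// muleA -EFinM muleC muleA -EFinM.
rewrite (_ : (_ * _)%R = 1%R) ?mul1e//.
by rewrite -c2; field; rewrite gt_eqF.
Qed.

(** By homogeneity, from the function h divided by its L^(3/2) norm. *)
Lemma radon_norm_le (h : mR * mR -> R) : measurable_fun setT h ->
  (forall q, (0 <= h q)%R) ->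
  0 < \int[leb \x leb]_q (h q)%:E `^ (3 / 2) < +oo ->
  \int[arc_lebesgue R]_p (radon h p) `^ 3 <=
  radon_norm R `^ 3 * (\int[leb \x leb]_q (h q)%:E `^ (3 / 2)) `^ 2.
Proof.
move=> mh h0 /andP[I0 Ioo]; set I := (X in X `^ 2).
have r0 p : 0 <= radon h p.
  by case: p => sigma s; apply: integral_ge0 => u _; rewrite lee_fin.
pose i : R := fine I.
have iE : I = i%:E by rewrite fineK// ge0_fin_numE// ltW.
have i0 : (0 < i)%R by rewrite -lte_fin -iE.
pose c : R := (i `^ (2 / 3))%R.
have c0 : (0 < c)%R by exact: powR_gt0.
pose f q : R := (c^-1 * h q)%R.
have mf : measurable_fun setT f by exact: measurable_funM.
have f0 q : (0 <= f q)%R by rewrite mulr_ge0// invr_ge0 ltW.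
have If : \int[leb \x leb]_q (f q)%:E `^ (3 / 2) = 1.
  under eq_integral do rewrite EFinM poweRM ?lee_fin ?invr_ge0 ?(ltW c0)//.
  rewrite ge0_integralZl//; last 3 first.
  - by apply: emeasurable_poweR; exact/measurable_EFinP.
  - by move=> q _; exact: poweR_ge0.
  - exact: poweR_ge0.
  rewrite -/I iE poweR_EFin -EFinM; congr EFin.
  rewrite /c -powR_inv1 ?powR_ge0// -!powRrM.
  rewrite (_ : (2 / 3 * (-1 * (3 / 2)) = -1)%R); last by field.
  by rewrite powR_inv1 ?mulVf ?gt_eqF// ltW.
have Nf : 'N[lebesgue_plane R]_(3 / 2)%:E[EFin \o f] = 1.
  rewrite unlock.
  transitivity ((\int[leb \x leb]_q (f q)%:E `^ (3 / 2)) `^ (3 / 2)^-1).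
    by congr (_ `^ _); apply: eq_integral => q _; rewrite /= ger0_norm.
  by rewrite If poweR1r.
have Rf : 'N[arc_lebesgue R]_3%:E[radon f] <= radon_norm R.
  apply: ereal_sup_ubound; exists f => //=; split; last by rewrite Nf.
  rewrite inE; apply/andP; split; rewrite inE//=.
  by rewrite /finite_norm Nf ltry.
have {}Rf : \int[arc_lebesgue R]_p (radon f p) `^ 3 <= radon_norm R `^ 3.
  have <- : 'N[arc_lebesgue R]_3%:E[radon f] `^ 3 =
      \int[arc_lebesgue R]_p (radon f p) `^ 3.
    rewrite poweR_Lnorm//; apply: eq_integral => p _; rewrite gee0_abs//.
    by case: p => sigma s; apply: integral_ge0 => u _; rewrite lee_fin.
  apply: gt0_ler_poweR => //; rewrite ?in_itv/= ?leey ?andbT ?Lnorm_ge0//.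
  by apply: le_trans Rf; exact: Lnorm_ge0.
have rE p : radon h p = c%:E * radon f p.
  case: p => sigma s; rewrite /radon -ge0_integralZl//.
  - by apply: eq_integral => u _; rewrite -EFinM mulrA mulfV ?mul1r ?gt_eqF.
  - exact: (measurableT_comp (measurable_line_param mf)
      (pair1_measurable (sigma, s))).
  - by move=> u _; rewrite lee_fin.
  - by rewrite lee_fin ltW.
have rf0 p : 0 <= radon f p.
  by case: p => sigma s; apply: integral_ge0 => u _; rewrite lee_fin.
under eq_integral do rewrite rE (poweRM _ _ (rf0 _)) ?lee_fin ?(ltW c0)//.
rewrite ge0_integralZl//; last 3 first.
- by apply: emeasurable_poweR; exact: measurable_radon.
- by move=> p _; exact: poweR_ge0.
- exact: poweR_ge0.
rewrite muleC iE; apply: (le_trans (lee_wpmul2r _ Rf)); first exact: poweR_ge0.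
rewrite !poweR_EFin /c -powRrM (_ : (2 / 3 * 3 = 2)%R)//.
by field.
Qed.

(** A function h of norm 0 cannot be normalized. In this case the integral in s
    of [xray h] at any fixed slope x is the integral of h, hence 0. *)
Lemma xray_norm_le (h : mR * mR -> R) : measurable_fun setT h ->
  (forall q, (0 <= h q)%R) ->
  \int[leb \x leb]_q (h q)%:E `^ (3 / 2) < +oo ->
  \int[leb \x leb]_p (xray (EFin \o h) p) `^ 3 <=
  radon_norm R `^ 3 * (\int[leb \x leb]_q (h q)%:E `^ (3 / 2)) `^ 2.
Proof.
move=> mh h0 Ioo.
have mEh : measurable_fun setT (EFin \o h) by exact/measurable_EFinP.
have Eh0 q : 0 <= (EFin \o h) q by rewrite lee_fin.
have : 0 <= \int[leb \x leb]_q (h q)%:E `^ (3 / 2).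
  by apply: integral_ge0 => q _; exact: poweR_ge0.
rewrite le_eqVlt => /predU1P[/esym I0|I0]; last first.
  apply: le_trans (ge0_xray_le_radon mh h0) _.
  by apply: radon_norm_le => //; rewrite I0.
rewrite I0 poweR0r// mule0.
have h_0 : \int[leb \x leb]_q (h q)%:E = 0.
  transitivity (\int[leb \x leb]_q ((h q)%:E `^ (3 / 2)) `^ (2 / 3)).
    apply: eq_integral => q _.
    rewrite -poweRrM (_ : (3 / 2 * (2 / 3))%R = 1%R); last by field.
    by rewrite poweRe1// lee_fin.
  apply: integral_poweR_eq0 => //; first exact: emeasurable_poweR.
  by move=> q; exact: poweR_ge0.
have mX := measurable_xray mEh Eh0.
have X0 p := xray_ge0 p Eh0.
rewrite fubini_tonelli1; last 2 first.
- exact: emeasurable_poweR.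
- by move=> p; exact: poweR_ge0.
rewrite integral0_eq// => x _; rewrite /fubini_F.
apply: integral_poweR_eq0 => //; first exact: measurableT_comp.
pose g (q : mR * mR) : \bar R := (h (q.2, (q.1 + x * q.2)%R))%:E.
have mg : measurable_fun setT g.
  apply/measurable_EFinP; apply: (measurableT_comp mh).
  apply: measurable_fun_pair => //=; apply: measurable_funD => //.
  exact: measurable_funM.
have g0 q : 0 <= g q by rewrite lee_fin.
rewrite -[LHS]/(\int[leb]_s \int[leb]_y g (s, y)) fubini_tonelli//.
rewrite -h_0 fubini_tonelli1//; apply: eq_integral => y _.
rewrite /g/=; apply: (ge0_integral_shift (x * y)%R (f := fun s => (h (y, s))%:E)).
  exact: (measurableT_comp mEh (pair1_measurable y)).
by move=> s; rewrite lee_fin.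
Qed.

End arc_integrals.

(** * Monotone approximation *)

Section truncation.
Context d (T : measurableType d) (R : realType).
Context (mu : {sigma_finite_measure set T -> \bar R}).
Local Open Scope ereal_scope.

Import HBNNSimple.

(** The operator norm of the Radon transform only controls real-valued functions
    of finite norm; any nonnegative measurable function is an increasing limit
    of such functions, namely of simple functions cut off to sets of finite
    measure. *)
Lemma exists_truncation (f : T -> \bar R) (r : R) :
  measurable_fun setT f -> (forall x, 0 <= f x) -> (0 < r)%R ->
  exists g : nat -> T -> R,
    [/\ forall k, measurable_fun setT (g k),
        forall k x, (0 <= g k x)%R,
        forall x, nondecreasing_seq (g ^~ x),
        forall x, (g k x)%:E @[k --> \oo] --> f x &
        forall k, \int[mu]_x (g k x)%:E `^ r < +oo].
Proof.
move=> mf f0 r0.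
have /sigma_finiteP[F [TF ndF Foo]] := sigma_finiteT mu.
have mF k : measurable (F k) by have [] := Foo k.
pose a := nnsfun_approx measurableT mf.
have nda x m n : (m <= n)%N -> (a m x <= a n x)%R.
  by move=> mn; exact/lefP/nd_nnsfun_approx.
have FS x m n : (m <= n)%N -> F m x -> F n x by move=> mn; exact/subsetPset/ndF.
exists (fun k x => a k x * \1_(F k) x)%R; split.
- by move=> k; apply: measurable_funM => //; exact: measurable_indic.
- by move=> k x; rewrite mulr_ge0.
- move=> x m n mn; rewrite ler_pM// ?nda//.
  rewrite !indicE; case: (boolP (x \in F m)) => // /set_mem Fm.
  by rewrite mem_set//; exact: FS Fm.
- move=> x; have [m _ Fm] : (\bigcup_i F i) x by rewrite -TF.
  apply: cvg_trans (cvg_nnsfun_approx measurableT mf (fun x _ => f0 x) Logic.I).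
  apply: near_eq_cvg; exists m => // n /= mn.
  by rewrite indicE mem_set ?mulr1//; exact: FS Fm.
- move=> k; have [M aM] := bounded_fun_has_ubound (simple_bounded (a k)).
  have akM x : (a k x <= `|M|)%R.
    by apply: le_trans (ler_norm M); apply: aM; exists x.
  apply: (@le_lt_trans _ _ (\int[mu]_x ((`|M| `^ r)%:E * (\1_(F k) x)%:E))).
    apply: ge0_le_integral => //.
    + by move=> x _; exact: poweR_ge0.
    + apply: emeasurable_poweR; apply/measurable_EFinP.
      by apply: measurable_funM => //; exact: measurable_indic.
    + by apply: measurable_funeM; exact/measurable_EFinP/measurable_indic.
    + move=> x _; rewrite poweR_EFin -EFinM lee_fin indicE.
      case: (_ \in _); rewrite ?mulr1 ?mulr0; last by rewrite powR0// gt_eqF.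
      by rewrite ge0_ler_powR ?nnegrE// ltW.
  rewrite ge0_integralZl//; last exact/measurable_EFinP/measurable_indic.
  by rewrite integral_indic// setIT lte_mul_pinfty//; case: (Foo k).
Qed.

End truncation.

Section limits.
Context (R : realType).
Local Open Scope ereal_scope.

(** Monotonicity allows c = +oo: then c * u k is eventually +oo, unless u is
    identically 0. *)
Lemma nondecreasing_cvgeZl (c : \bar R) (u : nat -> \bar R) (l : \bar R) :
  0 <= c -> (forall k, 0 <= u k) -> nondecreasing_seq u ->
  u @ \oo --> l -> c * u k @[k --> \oo] --> c * l.
Proof.
move=> c0 u0 ndu ul; have [cfin|] := boolP (c \is a fin_num).
  exact: cvgeZl.
rewrite ge0_fin_numE// -leNgt leye_eq => /eqP ->.
have ul_le k : u k <= l.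
  rewrite (cvg_unique _ ul (ereal_nondecreasing_cvgn ndu))//.
  by apply: ereal_sup_ubound; exists k.
have [l0|l0] := leP l 0.
  have uk k : u k = 0 by apply/eqP; rewrite eq_le u0 (le_trans (ul_le k)).
  have -> : l = 0 by apply/eqP; rewrite eq_le l0 (le_trans (u0 0%N)).
  by under eq_fun do rewrite uk; exact: cvg_cst.
have [K uK] : exists K, 0 < u K.
  apply: contrapT => /forallNP uN; move: l0; rewrite ltNge => /negP; apply.
  by apply: cvge_le ul; apply: nearW => k; rewrite leNgt; apply/negP/uN.
rewrite (gt0_mulye l0); apply: cvg_near_cst.
exists K => // k /= Kk; rewrite gt0_mulye//.
exact: lt_le_trans (ndu _ _ Kk).
Qed.

End limits.

(** * The inequality with two coordinates *)

Section planar.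
Context (R : realType).
Local Notation mR := (measurableTypeR R).
Local Notation leb := (@lebesgue_measure R).
Local Notation leb2 := (sigma_finite_prod leb leb).
Local Open Scope ereal_scope.

Context (a : R) (a0 : (0 < a)%R).

(** The cube of the constant of the two-dimensional inequality; in dimension m
    the constant is the power 1 / (m + 1) of the same number. *)
Definition planar_const : \bar R := radon_norm R `^ 3 * a^-1%:E.

(* The integrand after translation in t, at the point q = ((x, t), y). *)
Let incidence (G h : mR * mR -> \bar R) (q : (mR * mR) * mR) : \bar R :=
  G q.1 `^ (2 / 3) * h (q.2, (q.1.2 + a * q.1.1 * q.2)%R).

Let measurable_incidence G h : measurable_fun setT G -> measurable_fun setT h ->
  measurable_fun setT (incidence G h).
Proof.
move=> mG mh; apply: emeasurable_funM.
  by apply: emeasurable_poweR; exact: measurableT_comp.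
apply: (measurableT_comp mh); apply: measurable_fun_pair => //=.
apply: measurable_funD; first exact: measurableT_comp.
by apply: measurable_funM => //; apply: measurable_funM => //;
  exact: measurableT_comp.
Qed.

Let incidence_ge0 G h q : (forall p, 0 <= h p) -> 0 <= incidence G h q.
Proof. by move=> h0; rewrite mule_ge0// poweR_ge0. Qed.

Let integral_xray_scale (h : mR * mR -> \bar R) :
  measurable_fun setT h -> (forall p, 0 <= h p) ->
  \int[leb \x leb]_p (xray h ((a * p.1)%R, p.2)) `^ 3 =
  a^-1%:E * \int[leb \x leb]_p (xray h p) `^ 3.
Proof.
move=> mh h0; have mX := measurable_xray mh h0.
pose F x := \int[leb]_t (xray h (x, t)) `^ 3.
have mX3 : measurable_fun setT (fun p => xray h p `^ 3).
  exact: emeasurable_poweR.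
have X30 p : 0 <= xray h p `^ 3 by exact: poweR_ge0.
have mF : measurable_fun setT F by exact: (measurable_fun_fubini_tonelli_F _ mX3).
have F0 x : 0 <= F x by exact: integral_ge0.
pose Xa3 (p : mR * mR) := xray h ((a * p.1)%R, p.2) `^ 3.
have mXa3 : measurable_fun setT Xa3.
  apply: emeasurable_poweR; apply: (measurableT_comp mX).
  by apply: measurable_fun_pair => //=; apply: measurable_funM.
have Xa30 p : 0 <= Xa3 p by exact: poweR_ge0.
rewrite (fubini_tonelli1 _ mX3 X30).
have := @ge0_integral_affine R a 0%R _ F mF F0.
rewrite gtr0_norm// => <-; last by rewrite gt_eqF.
rewrite (fubini_tonelli1 _ mXa3 Xa30); apply: eq_integral => x _.
by rewrite addr0.
Qed.

(* The integral in y is [xray h] at slope a x and intercept t. Hölder with the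
   weights 2/3 and 1/3 separates it from G, and rescaling the slope gives the
   factor 1 / a. *)
Let incidence_le_real (G : mR * mR -> \bar R) (h : mR * mR -> R) :
  measurable_fun setT G -> (forall p, 0 <= G p) ->
  measurable_fun setT h -> (forall p, (0 <= h p)%R) ->
  \int[leb \x leb]_q (h q)%:E `^ (3 / 2) < +oo ->
  \int[leb2 \x leb]_q incidence G (EFin \o h) q <=
  (\int[leb \x leb]_p G p) `^ (2 / 3) *
  (planar_const `^ 3^-1 * (\int[leb \x leb]_q (h q)%:E `^ (3 / 2)) `^ (2 / 3)).
Proof.
move=> mG G0 mh h0 hoo.
have mEh : measurable_fun setT (EFin \o h) by exact/measurable_EFinP.
have Eh0 q : 0 <= (EFin \o h) q by rewrite lee_fin.
have mX := measurable_xray mEh Eh0.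
have X0 p := xray_ge0 p Eh0.
have mXa : measurable_fun setT
    (fun p : mR * mR => xray (EFin \o h) ((a * p.1)%R, p.2)).
  apply: (measurableT_comp mX).
  by apply: measurable_fun_pair => //=; apply: measurable_funM.
have mi := measurable_incidence mG mEh.
have i0 q := incidence_ge0 G q Eh0.
rewrite (fubini_tonelli1 (m1 := leb2) (m2 := leb) _ mi i0).
rewrite (eq_integral (fun p => G p `^ (2 / 3) *
    (xray (EFin \o h) ((a * p.1)%R, p.2) `^ 3) `^ 3^-1)); last first.
  move=> p _; rewrite /fubini_F /incidence -poweRrM mulfV// poweRe1//=.
  rewrite ge0_integralZl//.
  - apply: (measurableT_comp mEh); apply: measurable_fun_pair => //.
    by apply: measurable_funD => //; exact: measurable_funM.
  - by move=> y _; rewrite lee_fin.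
  - exact: poweR_ge0.
apply: le_trans.
  apply: (@hoelder_weight2 _ _ _ leb2 (2 / 3) 3^-1 G) => //.
  - by field.
  - exact: emeasurable_poweR.
  - by move=> x; exact: poweR_ge0.
rewrite lee_wpmul2l ?poweR_ge0//.
rewrite integral_xray_scale//.
set I := \int[leb \x leb]_q (h q)%:E `^ (3 / 2).
have I0 : 0 <= I by apply: integral_ge0 => q _; exact: poweR_ge0.
have ai0 : 0 <= a^-1%:E by rewrite lee_fin invr_ge0 ltW.
have -> : I `^ (2 / 3) = (I `^ 2) `^ 3^-1 by rewrite -poweRrM.
rewrite /planar_const -poweRM ?mule_ge0 ?poweR_ge0//.
apply: gt0_ler_poweR; rewrite ?in_itv/= ?leey ?andbT ?mule_ge0 ?poweR_ge0//.
  by apply: integral_ge0 => q _; exact: poweR_ge0.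
rewrite muleAC muleC lee_wpmul2r//.
exact: xray_norm_le.
Qed.

Let incidence_le (G h : mR * mR -> \bar R) :
  measurable_fun setT G -> (forall p, 0 <= G p) ->
  measurable_fun setT h -> (forall p, 0 <= h p) ->
  \int[leb2 \x leb]_q incidence G h q <=
  (\int[leb \x leb]_p G p) `^ (2 / 3) *
  (planar_const `^ 3^-1 * (\int[leb \x leb]_q (h q) `^ (3 / 2)) `^ (2 / 3)).
Proof.
move=> mG G0 mh h0.
have [g [mg g0 ndg gh goo]] := exists_truncation leb2 mh h0
  (divr_gt0 (ltr0n R 3) (ltr0n R 2)).
have mEg k : measurable_fun setT (EFin \o g k) by exact/measurable_EFinP.
have ndi q : nondecreasing_seq (fun k => incidence G (EFin \o g k) q).
  by move=> m n mn; rewrite lee_wpmul2l ?poweR_ge0// lee_fin ndg.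
have cvi : \int[leb2 \x leb]_q incidence G (EFin \o g k) q @[k --> \oo] -->
    \int[leb2 \x leb]_q incidence G h q.
  have -> : \int[leb2 \x leb]_q incidence G h q = \int[leb2 \x leb]_q
      limn (fun k => incidence G (EFin \o g k) q).
    apply: eq_integral => q _; apply/esym/cvg_lim => //.
    apply: nondecreasing_cvgeZl => //.
    - exact: poweR_ge0.
    - by move=> k; rewrite lee_fin.
    - by move=> m n mn; rewrite lee_fin ndg.
    - exact: gh.
  apply: (@cvg_monotone_convergence _ _ _ (leb2 \x leb)%E _ measurableT
    (fun k => incidence G (EFin \o g k))) => //.
  - by move=> k; exact: measurable_incidence.
  - by move=> k q _; apply: incidence_ge0 => p; rewrite lee_fin.
have g_le k p : (g k p)%:E <= h p.
  have nd : nondecreasing_seq (fun n => (g n p)%:E).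
    by move=> m n mn; rewrite lee_fin ndg.
  rewrite (cvg_unique _ (gh p) (ereal_nondecreasing_cvgn nd))//.
  by apply: ereal_sup_ubound; exists k.
apply: cvge_le cvi.
apply: nearW => k.
apply: le_trans (incidence_le_real mG G0 (mg k) (g0 k) (goo k)) _.
rewrite !lee_wpmul2l ?poweR_ge0//.
apply: gt0_ler_poweR; rewrite ?in_itv/= ?leey ?andbT//.
- by apply: integral_ge0 => q _; rewrite lee_fin powR_ge0.
- by apply: integral_ge0 => q _; exact: poweR_ge0.
apply: ge0_le_integral => //.
- by move=> q _; rewrite lee_fin powR_ge0.
- exact: (emeasurable_poweR _ (mEg k)).
- exact: emeasurable_poweR.
- move=> q _; rewrite -poweR_EFin.
  by apply: gt0_ler_poweR; rewrite ?in_itv/= ?leey ?andbT ?lee_fin.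
Qed.

Lemma planar_loomis_whitney (G1 G2 : mR * mR -> \bar R) :
  measurable_fun setT G1 -> (forall p, 0 <= G1 p) ->
  measurable_fun setT G2 -> (forall p, 0 <= G2 p) ->
  \int[leb]_x \int[leb]_y \int[leb]_t
    (G1 (y, (t + a / 2 * (x * y))%R) `^ (2 / 3) *
     G2 (x, (t - a / 2 * (x * y))%R) `^ (2 / 3)) <=
  planar_const `^ 3^-1 * (\int[leb \x leb]_p G1 p) `^ (2 / 3) *
  (\int[leb \x leb]_p G2 p) `^ (2 / 3).
Proof.
move=> mG1 G10 mG2 G20.
pose h p := G1 p `^ (2 / 3).
have mh : measurable_fun setT h by exact: emeasurable_poweR.
have h0 p : 0 <= h p by exact: poweR_ge0.
have mi := measurable_incidence mG2 mh.
have i0 q : 0 <= incidence G2 h q by exact: incidence_ge0.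
have -> : \int[leb \x leb]_p G1 p = \int[leb \x leb]_p h p `^ (3 / 2).
  apply: eq_integral => p _; rewrite /h -poweRrM.
  by rewrite (_ : (2 / 3 * (3 / 2))%R = 1%R) ?poweRe1//; field.
rewrite muleC; apply: le_trans (incidence_le mG2 G20 mh h0).
have mF := measurable_fun_fubini_tonelli_F (m2 := leb) _ mi i0.
rewrite (fubini_tonelli1 (m1 := leb2) (m2 := leb) _ mi i0).
rewrite (fubini_tonelli1 (m1 := leb) (m2 := leb) _ mF
  (fun p => integral_ge0 _ (fun y _ => i0 (p, y)))).
rewrite le_eqVlt; apply/orP; left; apply/eqP; apply: eq_integral => x _.
rewrite /fubini_F.
have mix : measurable_fun setT (fun p : mR * mR => incidence G2 h (x, p.1, p.2)).
  apply: (measurableT_comp mi); apply: measurable_fun_pair => //=.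
  exact: measurable_fun_pair.
rewrite (fubini_tonelli (fun p : mR * mR => incidence G2 h (x, p.1, p.2)))//.
apply: eq_integral => y _.
have my : measurable_fun setT (fun t => incidence G2 h (x, t, y)).
  exact: (measurableT_comp mix (pair2_measurable y)).
rewrite -(ge0_integral_shift (- (a / 2 * (x * y)))%R my)//.
apply: eq_integral => t _; rewrite /incidence/= muleC; congr (_ * _).
by rewrite /h; congr (G1 (_, _) `^ _); field.
Qed.

End planar.

(** * The inequality for one pair of coordinates *)

Section pair.
Context (R : realType).
Local Notation mR := (measurableTypeR R).
Local Notation leb := (@lebesgue_measure R).
Local Notation leb_ m := (lebesgue_Rn R m \x leb)%E.
Local Notation sleb_ m := (sigma_finite_prod (lebesgue_Rn R m) leb).
Local Open Scope ereal_scope.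

Lemma ge0_integral_Rn0 (H : 0.-tuple mR * mR -> \bar R) :
  measurable_fun setT H -> (forall p, 0 <= H p) ->
  \int[leb_ 0]_p H p = \int[leb]_t H ([tuple], t).
Proof.
move=> mH H0.
rewrite (fubini_tonelli1 (m1 := lebesgue_Rn R 0) (m2 := leb) _ mH H0).
have mF := measurable_fun_fubini_tonelli_F (m2 := leb) _ mH H0.
transitivity (\int[\d_([tuple] : 0.-tuple mR)]_x fubini_F leb H x) => //.
by rewrite integral_dirac// diracT mul1e.
Qed.

#[local] Opaque lebesgue_Rn.

Lemma ge0_integral_Rn1 (H : 1.-tuple mR * mR -> \bar R) :
  measurable_fun setT H -> (forall p, 0 <= H p) ->
  \int[leb_ 1]_p H p =
  \int[leb \x leb]_p H (insert_coord ord0 p.1 [tuple], p.2).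
Proof.
move=> mH H0; rewrite (ge0_integral_insert_prod ord0 mH H0).
have mHi : measurable_fun setT
    (fun q : mR * (0.-tuple mR * mR) => H (insert_coord ord0 q.1 q.2.1, q.2.2)).
  apply: (measurableT_comp mH); apply: measurable_fun_pair => /=.
    by apply: measurable_insert_comp => //; exact: measurableT_comp.
  exact: measurableT_comp.
have mH2 : measurable_fun setT
    (fun p : mR * mR => H (insert_coord ord0 p.1 [tuple], p.2)).
  apply: (measurableT_comp mH); apply: measurable_fun_pair => //=.
  by apply: measurable_insert_comp.
rewrite (fubini_tonelli1 (m1 := leb) (m2 := leb) _ mH2 (fun p => H0 _)).
apply: eq_integral => z _.
rewrite (ge0_integral_Rn0 (H := fun v => H (insert_coord ord0 z v.1, v.2)))//.
exact: (measurableT_comp mHi (pair1_measurable z)).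
Qed.

(** The reciprocal exponents of the endpoint inequality in which the Radon
    transform is applied in the variables p and q only. *)
Definition pair_weight m (p q j : 'I_m) : R :=
  ((1 + (j == p) + (j == q))%N%:R / m.+1%:R)%R.

Lemma pair_weight_gt0 m (p q j : 'I_m) : (0 < pair_weight p q j)%R.
Proof. by rewrite divr_gt0// ltr0n. Qed.

Lemma pair_weight_lift m (i : 'I_m.+1) (p q j : 'I_m) :
  pair_weight (lift i p) (lift i q) (lift i j) =
  (pair_weight p q j * (m.+1%:R / m.+2%:R))%R.
Proof.
rewrite /pair_weight !(inj_eq lift_inj) mulrA divfK// pnatr_eq0//.
Qed.

Lemma pair_weight_notin m (p q j : 'I_m) : j != p -> j != q ->
  pair_weight p q j = m.+1%:R^-1%R.
Proof. by rewrite /pair_weight => /negbTE-> /negbTE->; rewrite mul1r. Qed.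

(** Once coordinate i is frozen, the weights of the functions that still depend
    on it add up to 1, as Hölder's inequality in that coordinate requires. *)
Lemma sum_pair_weight m (i : 'I_m.+1) (p q : 'I_m) : p != q ->
  (\sum_j pair_weight (lift i p) (lift i q) (lift i j) = 1)%R.
Proof.
move=> pq.
under eq_bigr do rewrite /pair_weight !(inj_eq lift_inj).
rewrite -mulr_suml -natr_sum !big_split/= sum1_card card_ord.
have E (k : 'I_m) : (\sum_(j < m) (j == k) = 1)%N.
  rewrite (bigD1 k)//= eqxx big1 ?addn0// => j /negbTE->//.
by rewrite !E !addn1 mulfV// pnatr_eq0.
Qed.

Context (a : R) (a0 : (0 < a)%R).

Section statement.
Context (m : nat) (p q : 'I_m) (S : 'I_m -> m.-tuple mR -> mR)
  (g : 'I_m -> m.-1.-tuple mR * mR -> \bar R).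

Definition sheared_prod (z : m.-tuple mR * mR) : \bar R :=
  \prod_j g j (del_coord j z.1, (z.2 + S j z.1)%R) `^ pair_weight p q j.

Lemma measurable_sheared (j : 'I_m) : (forall j, measurable_fun setT (S j)) ->
  measurable_fun setT
    (fun z : m.-tuple mR * mR => (del_coord j z.1, (z.2 + S j z.1)%R)).
Proof.
move=> mS; apply: measurable_fun_pair => /=.
  exact: (measurableT_comp (measurable_del_coord j) measurable_fst).
apply: measurable_funD; first exact: measurable_snd.
exact: (measurableT_comp (mS j) measurable_fst).
Qed.

Lemma measurable_sheared_prod : (forall j, measurable_fun setT (S j)) ->
  (forall j, measurable_fun setT (g j)) -> measurable_fun setT sheared_prod.
Proof.
move=> mS mg; apply: emeasurable_prod => j; apply: emeasurable_poweR.
exact: (measurableT_comp (mg j) (measurable_sheared j mS)).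
Qed.

Lemma sheared_prod_ge0 z : 0 <= sheared_prod z.
Proof. by apply: prode_ge0 => j _; exact: poweR_ge0. Qed.

End statement.

(** The shears are prescribed on the pair and arbitrary elsewhere. Freezing a
    coordinate outside the pair preserves this form, even if in the group that
    coordinate is coupled with another one. *)
Definition pair_inequality m (p q : 'I_m) : Prop :=
  forall (S : 'I_m -> m.-tuple mR -> mR) (g : 'I_m -> m.-1.-tuple mR * mR -> \bar R),
  (forall j, measurable_fun setT (S j)) ->
  (forall x, S p x = (a / 2 * (tnth x p * tnth x q))%R) ->
  (forall x, S q x = (- (a / 2 * (tnth x p * tnth x q)))%R) ->
  (forall j, measurable_fun setT (g j)) -> (forall j y, 0 <= g j y) ->
  \int[leb_ m]_z sheared_prod p q S g z <=
  planar_const a `^ m.+1%:R^-1 *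
    \prod_j (\int[leb_ m.-1]_y g j y) `^ pair_weight p q j.

(** The base case: [planar_loomis_whitney] with x the coordinate p and y the
    coordinate q. *)
Lemma pair_inequality2 (p q : 'I_2) : (p < q)%N -> pair_inequality p q.
Proof.
move=> pq; have p0 : p = ord0.
  by apply/val_inj => /=; case: p q pq => [[|[|p]]//= ?] [[|[|q]]//=].
have q1 : q = lift ord0 ord0.
  by apply/val_inj => /=; case: p q pq {p0} => [[|[|p]]//= ?] [[|[|q]]//=].
move=> S g mS Sp Sq mg g0.
have mF := measurable_sheared_prod p q mS mg.
have F0 := sheared_prod_ge0 p q S g.
pose G (j : 'I_2) (y : mR * mR) : \bar R := g j (insert_coord ord0 y.1 [tuple], y.2).
have mG j : measurable_fun setT (G j).
  apply: (measurableT_comp (mg j)); apply: measurable_fun_pair => //=.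
  by apply: measurable_insert_comp.
have IG j : \int[leb \x leb]_y G j y = \int[leb_ 1]_y g j y.
  by rewrite ge0_integral_Rn1.
have := planar_loomis_whitney a0 (mG p) (fun=> g0 _ _) (mG q) (fun=> g0 _ _).
rewrite !IG big_ord_recl big_ord_recl big_ord0 mule1 -q1 -p0.
have wp : pair_weight p q p = (2 / 3)%R.
  by rewrite /pair_weight eqxx (_ : p == q = false)// p0 q1.
have wq : pair_weight p q q = (2 / 3)%R.
  by rewrite /pair_weight eqxx (_ : q == p = false)// p0 q1.
rewrite wp wq muleA; apply: le_trans.
rewrite (ge0_integral_insert_prod p mF F0) le_eqVlt; apply/orP; left; apply/eqP.
apply: eq_integral => x _.
have mFx : measurable_fun setT (fun u : 1.-tuple mR * mR =>
    sheared_prod p q S g (insert_coord p x u.1, u.2)).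
  apply: (measurableT_comp mF); apply: measurable_fun_pair => //=.
  by apply: measurable_insert_comp.
rewrite (ge0_integral_Rn1 mFx (fun=> F0 _)).
have mFxy : measurable_fun setT (fun v : mR * mR =>
    sheared_prod p q S g (insert_coord p x (insert_coord ord0 v.1 [tuple]), v.2)).
  apply: (measurableT_comp mF); apply: measurable_fun_pair => //=.
  by apply: measurable_insert_comp => //; apply: measurable_insert_comp.
rewrite (fubini_tonelli1 (m1 := leb) (m2 := leb) _ mFxy (fun=> F0 _)).
apply: eq_integral => y _; apply: eq_integral => t _.
set u : 1.-tuple mR := insert_coord ord0 y [tuple].
have up : tnth (insert_coord p x u) p = x by rewrite tnth_insert.
have uq : tnth (insert_coord p x u) q = y.
  by rewrite q1 p0 tnth_insert_lift tnth_insert.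
rewrite /sheared_prod big_ord_recl big_ord_recl big_ord0 mule1 -q1 -p0 wp wq.
rewrite Sp Sq up uq /G/= del_coord_insert; congr (_ * g q (_, _) `^ _).
apply: eq_from_tnth => k; rewrite tnth_del_coord (_ : lift q k = p).
  by rewrite up (ord1 k) tnth_insert.
by apply/val_inj; rewrite q1 p0 (ord1 k).
Qed.

End pair.

Section pair_step.
Context (R : realType).
Local Notation mR := (measurableTypeR R).
Local Notation leb := (@lebesgue_measure R).
Local Notation leb_ m := (lebesgue_Rn R m \x leb)%E.
Local Notation sleb_ m := (sigma_finite_prod (lebesgue_Rn R m) leb).
Local Open Scope ereal_scope.

#[local] Opaque lebesgue_Rn.

Context (a : R).

(** Coordinate i is frozen at z. The function g i no longer depends on z except
    through a shear, so Hölder with the weights 1 / (m + 4) and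
    (m + 3) / (m + 4) in the remaining variables extracts its integral, and the
    inequality in dimension m + 2 applies to the other factors. The product of
    their integrals is then integrated in z by Hölder. *)
Lemma pair_inequalityS (m : nat) (i : 'I_m.+3) (p q : 'I_m.+2) : p != q ->
  pair_inequality a p q -> pair_inequality a (lift i p) (lift i q).
Proof.
move=> pq IH S g mS Sp Sq mg g0.
have mF := measurable_sheared_prod (lift i p) (lift i q) mS mg.
have F0 := sheared_prod_ge0 (lift i p) (lift i q) S g.
have [i_ iE] : exists i_ : 'I_m.+2 -> 'I_m.+2, forall j z (x : m.+2.-tuple mR),
    del_coord (lift i j) (insert_coord i z x) = insert_coord (i_ j) z (del_coord j x).
  have /fin_all_exists[i_ iE] := @del_coord_insert_lift R m.+1 i.
  by exists i_.
pose g' z j (y : m.+1.-tuple mR * mR) :=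
  g (lift i j) (insert_coord (i_ j) z y.1, y.2).
pose S' z j (x : m.+2.-tuple mR) := S (lift i j) (insert_coord i z x).
pose J j z := \int[leb_ m.+1]_y g' z j y.
have mg2 j : measurable_fun setT (fun v : mR * (m.+1.-tuple mR * mR) => g' v.1 j v.2).
  apply: (measurableT_comp (mg (lift i j))); apply: measurable_fun_pair => /=.
    by apply: measurable_insert_comp => //; exact: measurableT_comp.
  exact: measurableT_comp.
have mJ j : measurable_fun setT (J j).
  exact: (measurable_fun_fubini_tonelli_F (m2 := sleb_ m.+1) _ (mg2 j) (fun=> g0 _ _)).
have J0 j z : 0 <= J j z by apply: integral_ge0 => y _; exact: g0.
have IJ j : \int[leb]_z J j z = \int[leb_ m.+2]_y g (lift i j) y.
  by rewrite (ge0_integral_insert_prod (i_ j) (mg (lift i j)) (g0 (lift i j))).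
pose w j := pair_weight R (lift i p) (lift i q) j.
pose A := \int[leb_ m.+2]_y g i y.
have A0 : 0 <= A by apply: integral_ge0 => y _; exact: g0.
pose K := planar_const a `^ m.+4%:R^-1.
have K0 : 0 <= K by exact: poweR_ge0.
have wi : w i = m.+4%:R^-1%R by rewrite /w pair_weight_notin// neq_lift.
have fiber z : \int[leb_ m.+2]_y
      sheared_prod (lift i p) (lift i q) S g (insert_coord i z y.1, y.2) <=
    A `^ w i * K * \prod_j J j z `^ w (lift i j).
  pose r : R := (m.+3%:R / m.+4%:R)%R.
  have r0 : (0 < r)%R by rewrite divr_gt0// ltr0n.
  pose B (y : m.+2.-tuple mR * mR) := g i (y.1, (y.2 + S i (insert_coord i z y.1))%R).
  have mSi : measurable_fun setT (fun x : m.+2.-tuple mR => S i (insert_coord i z x)).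
    by apply: (measurableT_comp (mS i)); exact: measurable_insert_comp.
  have mB : measurable_fun setT B := measurableT_comp (mg i) (measurable_shear mSi).
  have B0 y : 0 <= B y by exact: g0.
  have IB : \int[leb_ m.+2]_y B y = A.
    exact: (ge0_integral_shear (lebesgue_Rn R m.+2) mSi (mg i) (g0 i)).
  have mS' j : measurable_fun setT (S' z j).
    by apply: (measurableT_comp (mS (lift i j))); exact: measurable_insert_comp.
  have mg' j : measurable_fun setT (g' z j).
    exact: (measurableT_comp (mg2 j) (pair1_measurable z)).
  have g'0 j y : 0 <= g' z j y by exact: g0.
  have mP := measurable_sheared_prod p q mS' mg'.
  have P0 := sheared_prod_ge0 p q (S' z) (g' z).
  have wr j : w (lift i j) = (pair_weight R p q j * r)%R.
    exact: pair_weight_lift.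
  have E y : sheared_prod (lift i p) (lift i q) S g (insert_coord i z y.1, y.2) =
      B y `^ w i * sheared_prod p q (S' z) (g' z) y `^ r.
    rewrite /sheared_prod (bigD1_ord i)//= del_coord_insert; congr (_ * _).
    rewrite prode_poweR; last by move=> j; exact: poweR_ge0.
    by apply: eq_bigr => j _; rewrite iE -poweRrM -wr.
  under eq_integral do rewrite E.
  apply: le_trans.
    apply: (@hoelder_weight2 _ _ _ (leb_ m.+2) (w i) r _ _ _ _ _ mB mP B0 P0) => //.
      exact: pair_weight_gt0.
    rewrite wi /r -{1}[(m.+4%:R^-1)%R]mul1r -mulrDl -[1%R]/(1%:R)%R -natrD.
    by rewrite add1n mulfV// pnatr_eq0.
  rewrite IB -muleA; apply: lee_wpmul2l; first exact: poweR_ge0.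
  have := IH (S' z) (g' z) mS' _ _ mg' g'0.
  set I := \int[_]_y _ => IHz.
  have I0 : 0 <= I by apply: integral_ge0 => y _; exact: P0.
  have {}IHz : I <= planar_const a `^ m.+3%:R^-1 *
      \prod_j J j z `^ pair_weight R p q j.
    by apply: IHz => x; rewrite /S' ?Sp ?Sq !tnth_insert_lift.
  have PJ0 : 0 <= \prod_j J j z `^ pair_weight R p q j.
    by apply: prode_ge0 => j _; exact: poweR_ge0.
  apply: (@le_trans _ _ ((planar_const a `^ m.+3%:R^-1 *
      \prod_j J j z `^ pair_weight R p q j) `^ r)).
    apply: gt0_ler_poweR; rewrite ?in_itv/= ?leey ?andbT//; first exact: ltW.
    by rewrite mule_ge0 ?poweR_ge0.
  rewrite poweRM ?poweR_ge0// -poweRrM prode_poweR; last first.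
    by move=> j; exact: poweR_ge0.
  rewrite /r mulrA mulVf ?pnatr_eq0// mul1r -/K.
  by under eq_bigr do rewrite -poweRrM -wr.
rewrite (ge0_integral_insert_prod i mF F0).
have mJw : measurable_fun setT (fun z => \prod_j J j z `^ w (lift i j)).
  by apply: emeasurable_prod => j; exact: emeasurable_poweR.
have Jw0 z : 0 <= \prod_j J j z `^ w (lift i j).
  by apply: prode_ge0 => j _; exact: poweR_ge0.
apply: (@le_trans _ _ (\int[leb]_z (A `^ w i * K * \prod_j J j z `^ w (lift i j)))).
  apply: ge0_le_integral => //.
  - by move=> z _; apply: integral_ge0 => y _; exact: F0.
  - apply: (measurable_fun_fubini_tonelli_F (m2 := sleb_ m.+2)
      (fun v : mR * (m.+2.-tuple mR * mR) =>
        sheared_prod (lift i p) (lift i q) S g (insert_coord i v.1 v.2.1, v.2.2))).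
      apply: (measurableT_comp mF); apply: measurable_fun_pair => /=.
        by apply: measurable_insert_comp => //; exact: measurableT_comp.
      exact: measurableT_comp.
    by move=> v; exact: F0.
  - exact: measurable_funeM.
rewrite ge0_integralZl//; last by rewrite mule_ge0// poweR_ge0.
rewrite (bigD1_ord i)//= -/A -/(w i) muleA (muleC K).
apply: lee_wpmul2l; first by rewrite mule_ge0// poweR_ge0.
apply: le_trans (hoelder_prod leb _ _ mJ J0) _.
- by move=> j; exact: pair_weight_gt0.
- exact: sum_pair_weight.
rewrite le_eqVlt; apply/orP; left; apply/eqP; apply: eq_bigr => j _.
by congr (_ `^ _); exact: IJ.
Qed.

End pair_step.

Section all_dimensions.
Context (R : realType).
Local Notation mR := (measurableTypeR R).
Context (a : R) (a0 : (0 < a)%R).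

Lemma pair_inequality_holds (m : nat) (p q : 'I_m) : (p < q)%N ->
  pair_inequality a p q.
Proof.
elim: m p q => [[]//|[|[|m]] IH p q pq].
- by move: pq; rewrite !ord1.
- exact: pair_inequality2.
have [i /andP[ip iq]] : exists i : 'I_m.+3, (i != p) && (i != q).
  apply/existsP; apply: contraT; rewrite negb_exists => /forallP ipq.
  have : (#|'I_m.+3| <= #|pred2 p q|)%N.
    apply/subset_leq_card/fintype.subsetP => i _.
    by have := ipq i; rewrite negb_and !negbK !inE.
  by rewrite card_ord card2; case: (p != q).
have [p' pE|/eqP] := unliftP i p; last by rewrite eq_sym (negbTE ip).
have [q' qE|/eqP] := unliftP i q; last by rewrite eq_sym (negbTE iq).
have pq' : (p' < q')%N by move: pq; rewrite pE qE /= /bump; lia.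
rewrite pE qE; apply: pair_inequalityS => //; last exact: IH.
by apply: contraTneq pq' => ->; rewrite ltnn.
Qed.

End all_dimensions.

(** * Borel envelopes of Lebesgue measurable functions *)

Section borel_envelopes.
Context d (T : measurableType d) (R : realType) (mu : {measure set T -> \bar R}).
Local Open Scope ereal_scope.

Import HBNNSimple.

Lemma ge0_le_integral_nonmeasurable (f g : T -> \bar R) :
  (forall x, 0 <= f x) -> (forall x, f x <= g x) ->
  \int[mu]_x f x <= \int[mu]_x g x.
Proof.
move=> f0 fg; have g0 x : 0 <= g x := le_trans (f0 x) (fg x).
rewrite !ge0_integralTE//; apply: ereal_sup_le => _ [h hf <-]; exists h => //.
by move=> x; exact: le_trans (hf x) (fg x).
Qed.

Let rat_of_nat (k : nat) : rat := odflt 0%R (unpickle k).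

Let itv_bigcup (r : R) :
  (`]r%:E, +oo[%classic : set \bar R) =
  \bigcup_(k in [set k | (r < ratr (rat_of_nat k))%R])
    `](ratr (rat_of_nat k))%:E, +oo[%classic.
Proof.
apply/seteqP; split => [x|x [k /= rk]]; last first.
  by rewrite /= !in_itv/= !andbT; apply: lt_trans; rewrite lte_fin.
rewrite /= in_itv/= andbT => rx.
have [q rq qx] : exists2 q : rat, (r < ratr q)%R & (ratr q)%:E < x.
  case: x rx => [x| |//].
    rewrite lte_fin => /rat_in_itvoo[q]; rewrite in_itv/= => /andP[rq qx].
    by exists q => //; rewrite lte_fin.
  move=> _; have /rat_in_itvoo[q] : (r < r + 1)%R by rewrite ltrDl.
  by rewrite in_itv/= => /andP[rq _]; exists q => //; rewrite ltry.
have qE : rat_of_nat (pickle q) = q by rewrite /rat_of_nat pickleK.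
by exists (pickle q); rewrite /= ?qE// in_itv/= andbT.
Qed.

(** For each rational q the set f > q is Borel up to a null set. Let B be a
    Borel null set containing these countably many exceptional sets; the envelopes
    equal f outside B, and 0, respectively +oo, on B. *)
Lemma borel_envelopes (f : T -> \bar R) : mu_measurable mu f ->
  (forall x, 0 <= f x) ->
  exists g h : T -> \bar R,
    [/\ measurable_fun setT g, measurable_fun setT h,
        forall x, 0 <= g x <= f x, forall x, f x <= h x & ae_eq mu setT g h].
Proof.
move=> mf f0.
have /choice[A AP] (k : nat) : exists A : set T * set T,
    [/\ measurable A.1, measurable A.2, mu A.2 = 0,
      A.1 `<=` f @^-1` `](ratr (rat_of_nat k))%:E, +oo[%classic &
      f @^-1` `](ratr (rat_of_nat k))%:E, +oo[%classic `<=` A.1 `|` A.2].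
  have : measurable (`](ratr (rat_of_nat k))%:E, +oo[%classic : set \bar R).
    exact: emeasurable_itv.
  move=> /mf[A mA [N [B [mB B0 NB]]] ANE].
  exists (A, B); split => //=; rewrite -ANE; first by move=> x; left.
  exact: setUS.
pose B := \bigcup_k (A k).2.
have mB : measurable B by apply: bigcupT_measurable => k; have [] := AP k.
have B0 : mu B = 0.
  have : mu.-negligible B.
    apply: negligible_bigcup => k; have [_ mAk Ak0 _ _] := AP k.
    by exists (A k).2; split.
  by move=> /negligibleP; apply.
pose h x : \bar R := if x \in B then +oo else f x.
have mh : measurable_fun setT h.
  apply: (measurability _ (ErealGenOInfty.measurableE R)).
  move=> _ [_ [r ->] <-]; rewrite setTI itv_bigcup preimage_bigcup.
  apply: bigcup_measurable => k _.
  have [mA1 mA2 _ A1f fA] := AP k.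
  rewrite (_ : _ @^-1` _ = (A k).1 `|` B); first exact: measurableU.
  apply/seteqP; split => x /=; rewrite !in_itv/= !andbT /h.
    case: ifPn => [/set_mem Bx _|xB fx]; first by right.
    have [|A2] : ((A k).1 `|` (A k).2) x; [|by left|].
      by apply: fA; rewrite /= in_itv/= andbT.
    by right; exists k.
  case: ifPn => [_ _|xB [A1|]]; first by rewrite ltry.
    by have := A1f _ A1; rewrite /= in_itv/= andbT.
  by move: xB; rewrite notin_setE.
pose g x : \bar R := h x * (\1_(~` B) x)%:E.
have gE x : g x = if x \in B then 0 else f x.
  rewrite /g /h indicE in_setC; case: (x \in B) => /=; first by rewrite mule0.
  by rewrite mule1.
exists g, h; split => //.
- apply: emeasurable_funM => //; apply/measurable_EFinP.
  by apply: measurable_indic; exact: measurableC.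
- by move=> x; rewrite gE; case: ifP; rewrite ?lexx ?f0.
- by move=> x; rewrite /h; case: ifP; rewrite ?leey.
- exists B; split => // x /= ghx; apply: contrapT => xB; apply: ghx => _.
  by rewrite gE /h memNset.
Qed.

(** The integral of f is the supremum of the integrals of the simple functions
    below it, so it is squeezed between those of two Borel functions which are
    equal almost everywhere. *)
Lemma borel_majorant (f : T -> \bar R) : mu_measurable mu f ->
  (forall x, 0 <= f x) ->
  exists h : T -> \bar R,
    [/\ measurable_fun setT h, forall x, f x <= h x &
        forall r, (0 < r)%R -> \int[mu]_x (h x `^ r) = \int[mu]_x (f x `^ r)].
Proof.
move=> mf f0; have [g [h [mg mh gf fh gh]]] := borel_envelopes mf f0.
exists h; split => // r r0; apply/eqP; rewrite eq_le.
have pow_le (u v : \bar R) : 0 <= u -> u <= v -> u `^ r <= v `^ r.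
  move=> u0 uv; have v0 := le_trans u0 uv.
  by apply: gt0_ler_poweR; rewrite ?in_itv/= ?leey ?andbT// ltW.
have g0 x : 0 <= g x by case/andP : (gf x).
have h0 x : 0 <= h x := le_trans (f0 x) (fh x).
apply/andP; split; last first.
  by apply: ge0_le_integral_nonmeasurable => x; [exact: poweR_ge0|exact: pow_le].
rewrite (_ : \int[mu]_x h x `^ r = \int[mu]_x g x `^ r).
  apply: ge0_le_integral_nonmeasurable => x; first exact: poweR_ge0.
  by apply: pow_le => //; case/andP : (gf x).
apply: ge0_ae_eq_integral => //.
- exact: emeasurable_poweR.
- exact: emeasurable_poweR.
- by move=> x _; exact: poweR_ge0.
- by move=> x _; exact: poweR_ge0.
by apply: filterS gh => x /= gh /gh ->.
Qed.

End borel_envelopes.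

(** * Averaging over the pairs *)

Section assembly.
Context (R : realType) (d n : nat) (n_gt0 : (0 < n)%N) (alpha : n.-tuple R).
Context (alpha_gt0 : forall k, (0 < tnth alpha k)%R).
Local Notation mR := (measurableTypeR R).
Local Notation leb := (@lebesgue_measure R).
Local Notation N := (d + 2 * n)%N.
Local Open Scope ereal_scope.

#[local] Opaque lebesgue_Rn.

Let pair_fst_subproof (k : 'I_n) : (d + 2 * k < N)%N.
Proof. by have := ltn_ord k; lia. Qed.

Let pair_snd_subproof (k : 'I_n) : ((d + 2 * k).+1 < N)%N.
Proof. by have := ltn_ord k; lia. Qed.

Definition pair_fst (k : 'I_n) : 'I_N := Ordinal (pair_fst_subproof k).
Definition pair_snd (k : 'I_n) : 'I_N := Ordinal (pair_snd_subproof k).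

Let half_even (k : nat) : ((d + 2 * k - d)./2 = k)%N.
Proof. by rewrite addKn mul2n doubleK. Qed.

Let odd_even (k : nat) : odd (d + 2 * k - d) = false.
Proof. by rewrite addKn mul2n odd_double. Qed.

Let half_odd (k : nat) : (((d + 2 * k).+1 - d)./2 = k)%N.
Proof. by rewrite -addnS addKn mul2n/= uphalf_double. Qed.

Let odd_odd (k : nat) : odd ((d + 2 * k).+1 - d) = true.
Proof. by rewrite -addnS addKn mul2n/= odd_double. Qed.

Definition heis_shift (j : 'I_N) (x : N.-tuple mR) : mR :=
  let k := (j - d)./2 in
  let b := (alpha`_k / 2 * (x`_(d + 2 * k) * x`_(d + 2 * k).+1))%R in
  if (j < d)%N then 0%R else if odd (j - d) then (- b)%R else b.

Lemma heis_proj_shift j (p : heis R d n) :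
  heis_proj alpha j p = (del_coord j p.1, (p.2 + heis_shift j p.1)%R).
Proof.
case: p => x t; rewrite /heis_proj /heis_shift /=; congr pair.
by case: ifP => _; [rewrite addr0|case: ifP].
Qed.

Lemma heis_shift_fst k x : heis_shift (pair_fst k) x =
  (tnth alpha k / 2 * (tnth x (pair_fst k) * tnth x (pair_snd k)))%R.
Proof.
rewrite /heis_shift !(tnth_nth 0%R)/=.
rewrite (_ : (d + 2 * k < d)%N = false); last by lia.
by rewrite half_even odd_even.
Qed.

Lemma heis_shift_snd k x : heis_shift (pair_snd k) x =
  (- (tnth alpha k / 2 * (tnth x (pair_fst k) * tnth x (pair_snd k))))%R.
Proof.
rewrite /heis_shift !(tnth_nth 0%R)/=.
rewrite (_ : ((d + 2 * k).+1 < d)%N = false); last by lia.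
by rewrite half_odd odd_odd.
Qed.

Lemma measurable_nth m (i : nat) :
  measurable_fun setT (fun x : m.-tuple mR => x`_i : mR).
Proof.
have [im|mi] := ltnP i m; last first.
  by under eq_fun do rewrite nth_default ?size_tuple//; exact: measurable_cst.
rewrite (_ : (fun x => _) = (fun x => tnth x (Ordinal im))).
  exact: measurable_tnth.
by apply/funext => x; rewrite (tnth_nth 0%R).
Qed.

Lemma measurable_heis_shift j : measurable_fun setT (heis_shift j).
Proof.
rewrite /heis_shift; case: (j < d)%N; first exact: measurable_cst.
have mb : measurable_fun setT (fun x : N.-tuple mR => (alpha`_((j - d)./2) / 2 *
    (x`_(d + 2 * (j - d)./2) * x`_(d + 2 * (j - d)./2).+1))%R : mR).
  apply: measurable_funM; first exact: measurable_cst.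
  by apply: measurable_funM; exact: measurable_nth.
by case: (odd (j - d)) => //; exact: measurableT_comp.
Qed.

Definition LW_weight (j : 'I_N) : R :=
  (if (j < d)%N then (N + 1)%:R
   else (n * (N + 1))%:R / (n + 1)%:R)^-1%R.

(** Each coordinate j >= d belongs to exactly one pair, so that the numerators 1
    or 2 of its n weights add up to n + 1; a coordinate j < d belongs to none,
    and they add up to n. *)
Lemma LW_weight_mean j :
  LW_weight j = (\sum_k n%:R^-1 * pair_weight R (pair_fst k) (pair_snd k) j)%R.
Proof.
rewrite /pair_weight -mulr_sumr -mulr_suml -natr_sum.
have -> : (\sum_(k < n) (1 + (j == pair_fst k) + (j == pair_snd k)) =
    n + (d <= j))%N.
  under eq_bigr do rewrite -addnA.
  rewrite big_split/= sum1_card card_ord; congr addn.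
  have [dj|jd] := leqP d j; last first.
    by rewrite big1// => k _; rewrite -!val_eqE/=; lia.
  have kn : ((j - d)./2 < n)%N by have := ltn_ord j; lia.
  rewrite (bigD1 (Ordinal kn))//= big1 ?addn0; last first.
    by move=> k; rewrite -!val_eqE/=; lia.
  by rewrite -!val_eqE/=; lia.
rewrite /LW_weight ltnNge; case: leqP => _ /=; rewrite !addn1 ?addn0.
  by rewrite natrM invf_div invfM mulrCA mulrC.
by rewrite mulrA mulVf ?mul1r// pnatr_eq0 -lt0n.
Qed.

Lemma LW_const_prod :
  \prod_(k < n) (planar_const (tnth alpha k) `^ N.+1%:R^-1) `^ n%:R^-1 =
  LW_const d alpha.
Proof.
have n0 : (n%:R != 0 :> R)%R by rewrite pnatr_eq0 -lt0n.
pose e : R := (n * (N + 1))%:R^-1%R.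
have eE : (N.+1%:R^-1 * n%:R^-1)%R = e.
  by rewrite /e addn1 natrM invfM mulrC.
under eq_bigr => k _.
  rewrite -poweRrM eE /planar_const poweRM ?poweR_ge0//; last first.
    by rewrite lee_fin invr_ge0 ltW.
  over.
rewrite big_split/= /LW_const -/e; congr (_ * _).
  rewrite -poweR_sum ?poweR_ge0//; last by rewrite /e invr_ge0.
  rewrite sumr_const card_ord -poweRrM; congr (_ `^ _).
  by rewrite -[(e *+ n)%R]mulr_natr /e natrM invfM mulrAC mulVf// mul1r.
have P0 : (0 < \prod_k tnth alpha k)%R by rewrite prodr_gt0.
under eq_bigr do rewrite -poweR_EFin.
rewrite -prode_poweR; last by move=> k; rewrite lee_fin invr_ge0 ltW.
rewrite prodEFin poweR_EFin inver gt_eqF ?powR_gt0//; congr EFin.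
rewrite prodfV -powR_inv1 ?ltW// -powRrM -[in RHS]powR_inv1 ?powR_ge0//.
by rewrite -powRrM mulrC.
Qed.

(** By [LW_weight_mean] the integrand is the geometric mean over k of the
    integrands of the inequalities for the n pairs. *)
Lemma loomis_whitney_powers (g : 'I_N -> N.-1.-tuple mR * mR -> \bar R) :
  (forall j, measurable_fun setT (g j)) -> (forall j y, 0 <= g j y) ->
  \int[lebesgue_Rn R N \x leb]_p
    \prod_j g j (heis_proj alpha j p) `^ LW_weight j <=
  LW_const d alpha *
    \prod_j (\int[lebesgue_Rn R N.-1 \x leb]_y g j y) `^ LW_weight j.
Proof.
move=> mg g0.
pose pw k := pair_weight R (pair_fst k) (pair_snd k).
have pw0 k j : (0 <= n%:R^-1 * pw k j)%R.
  by rewrite mulr_ge0 ?invr_ge0// ltW// pair_weight_gt0.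
have split_mean (x : 'I_N -> \bar R) : (forall j, 0 <= x j) ->
    \prod_j x j `^ LW_weight j = \prod_k (\prod_j x j `^ pw k j) `^ n%:R^-1.
  move=> x0.
  under eq_bigr do rewrite LW_weight_mean (poweR_sum _ _ (x0 _) (fun k => pw0 k _)).
  rewrite exchange_big/=; apply: eq_bigr => k _.
  rewrite prode_poweR; last by move=> j; exact: poweR_ge0.
  by apply: eq_bigr => j _; rewrite -poweRrM mulrC.
pose F k := sheared_prod (pair_fst k) (pair_snd k) heis_shift g.
have mF k : measurable_fun setT (F k).
  by apply: measurable_sheared_prod => //; exact: measurable_heis_shift.
have F0 k p : 0 <= F k p by exact: sheared_prod_ge0.
rewrite (eq_integral (fun p => \prod_k F k p `^ n%:R^-1)); last first.
  move=> p _; rewrite split_mean; last by move=> j; exact: g0.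
  apply: eq_bigr => k _; congr (_ `^ _); apply: eq_bigr => j _.
  by rewrite heis_proj_shift.
apply: le_trans (hoelder_prod _ _ _ mF F0) _.
- by move=> _; rewrite invr_gt0 ltr0n.
- by rewrite sumr_const card_ord -[LHS]mulr_natr mulVf// pnatr_eq0 -lt0n.
rewrite split_mean; last by move=> j; apply: integral_ge0 => y _; exact: g0.
rewrite -LW_const_prod -big_split/=; apply: lee_prod_nneg => k _.
rewrite poweR_ge0/= -poweRM ?poweR_ge0//; last first.
  by apply: prode_ge0 => j _; exact: poweR_ge0.
have H := @pair_inequality_holds R _ (alpha_gt0 k) N (pair_fst k) (pair_snd k)
  (ltnSn _) heis_shift g measurable_heis_shift (heis_shift_fst k)
  (heis_shift_snd k) mg g0.
apply: gt0_ler_poweR H; rewrite ?in_itv/= ?leey ?andbT ?invr_ge0//.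
  by apply: integral_ge0 => p _; exact: F0.
rewrite mule_ge0 ?poweR_ge0//.
by apply: prode_ge0 => j _; exact: poweR_ge0.
Qed.

End assembly.

Theorem theorem2 (R : realType) (d n : nat) (n_gt0 : (0 < n)%N)
    (alpha : n.-tuple R) (alpha_gt0 : forall k, 0 < tnth alpha k)
    (alpha_le : forall k l : 'I_n, (k <= l)%N -> tnth alpha k <= tnth alpha l)
    (f : 'I_(d + 2 * n) -> heis_base R d n -> \bar R)
    (mf : forall j, mu_measurable (lebesgue_base R d n) (f j))
    (f_ge0 : forall j y, (0 <= f j y)%E) :
  (\int[lebesgue_heis R d n]_p \prod_(j < d + 2 * n) f j (heis_proj alpha j p)
   <= LW_const d alpha *
      \prod_(j < d + 2 * n | (j < d)%N)
         'N[lebesgue_base R d n]_((d + 2 * n + 1)%:R%:E)[f j] *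
      \prod_(j < d + 2 * n | (d <= j)%N)
         'N[lebesgue_base R d n]_(((n * (d + 2 * n + 1))%:R / (n + 1)%:R)%:E)[f j])%E.
Proof.
have /choice[h hP] j := borel_majorant (mf j) (f_ge0 j).
have mh j : measurable_fun setT (h j) by have [] := hP j.
have fh j y : (f j y <= h j y)%E by have [] := hP j.
have h0 j y : (0 <= h j y)%E := le_trans (f_ge0 j y) (fh j y).
(* The exponent p_j. *)
pose e j : R := (LW_weight R (j : 'I_(d + 2 * n)))^-1.
have e0 j : 0 < e j.
  rewrite /e /LW_weight invrK; case: ifP => _; first by rewrite ltr0n addn1.
  by rewrite divr_gt0// ltr0n ?muln_gt0 ?n_gt0 addn1.
have hfE j : (\int[lebesgue_base R d n]_y (h j y `^ e j) =
    \int[lebesgue_base R d n]_y (f j y `^ e j))%E.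
  by have [_ _ ->] := hP j.
have NE j : ((\int[lebesgue_base R d n]_y (h j y `^ e j)) `^ LW_weight R j =
    'N[lebesgue_base R d n]_((e j)%:E)[f j])%E.
  rewrite hfE unlock /e invrK; congr (_ `^ _)%E.
  by apply: eq_integral => y _; rewrite gee0_abs.
have /= := @loomis_whitney_powers R d n n_gt0 alpha alpha_gt0
  (fun j y => (h j y `^ e j)%E) (fun j => emeasurable_poweR _ (mh j))
  (fun j y => poweR_ge0 _ _).
under eq_bigr do rewrite NE.
rewrite (bigID (fun j : 'I_(d + 2 * n) => (j < d)%N))/= muleA => LW.
have -> : (\prod_(j < d + 2 * n | (j < d)%N)
    'N[lebesgue_base R d n]_((d + 2 * n + 1)%:R%:E)[f j] =
    \prod_(j < d + 2 * n | (j < d)%N) 'N[lebesgue_base R d n]_((e j)%:E)[f j])%E.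
  by apply: eq_bigr => j jd; rewrite /e /LW_weight invrK jd.
have -> : (\prod_(j < d + 2 * n | (d <= j)%N)
    'N[lebesgue_base R d n]_(((n * (d + 2 * n + 1))%:R / (n + 1)%:R)%:E)[f j] =
    \prod_(j < d + 2 * n | ~~ (j < d)%N) 'N[lebesgue_base R d n]_((e j)%:E)[f j])%E.
  apply: eq_big => [j|j dj]; first by rewrite -leqNgt.
  by rewrite /e /LW_weight invrK ltnNge dj.
apply: le_trans LW; apply: ge0_le_integral_nonmeasurable => p.
  by apply: prode_ge0 => j _; exact: f_ge0.
apply: lee_prod_nneg => j _; rewrite f_ge0/= /e -poweRrM mulVf ?poweRe1//.
by rewrite -invr_eq0 gt_eqF// e0.
Qed.
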